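(* Let $G$ be a finite simple connected graph satisfying condition $(\sharp)$, and suppose that $I_{\mathcal{A}_G}$ has no minimal binomial of the form $B_w=B_w^{(+)}-B_w^{(-)}$ where $B_w$ is a circuit and $B_w^{(+)},B_w^{(-)}$ are squarefree monomials that are not indispensable monomials of $I_{\mathcal{A}_G}$. Then $\mathrm{bar}(I_{\mathcal{A}_G})=\mu(I_{\mathcal{A}_G})$.
   Context: $G$ has vertices $v_1,\ldots,v_n$ and edges $e_1,\ldots,e_m$. For an edge $e_i=\{v_j,v_k\}$ let $\mathbf a_i\in\mathbb{Z}^n$ have $1$ in positions $j,k$ and $0$ elsewhere; $\mathcal{A}_G=\{\mathbf a_1,\ldots,\mathbf a_m\}$, and $I_{\mathcal{A}_G}\subset K[x_1,\ldots,x_m]$ ($K$ a field) is the kernel of the $K$-algebra map $x_i\mapsto \mathbf t^{\mathbf a_i}$. Condition $(\sharp)$: there is no induced subgraph of $G$ consisting of two vertex-disjoint odd cycles joined by a path of length $\ge1$. For an even closed walk $w=(e_{i_1},\ldots,e_{i_{2s}})$, $B_w^{(+)}=\prod_{k=1}^s x_{i_{2k-1}}$, $B_w^{(-)}=\prod_{k=1}^s x_{i_{2k}}$, $B_w=B_w^{(+)}-B_w^{(-)}\in I_{\mathcal{A}_G}$. A circuit is a binomial $\mathbf x^{\mathbf u_+}-\mathbf x^{\mathbf u_-}$ with $\mathbf u$ a nonzero vector of $\ker_{\mathbb{Z}}(\mathcal{A}_G)$ of inclusion-minimal support and relatively prime coordinates. A binomial is minimal if it belongs to some minimal system of binomial generators.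 A monomial $M$ is indispensable if every system of binomial generators of $I_{\mathcal{A}_G}$ contains a binomial with $M$ as one of its monomials. $\mu$ is the cardinality of a minimal binomial generating set; $\mathrm{bar}(I)$ is the least number of binomials in $I$ generating $I$ up to radical. *)

(* Defs.v *)
From HB Require Import structures.
From mathcomp Require Import all_boot all_order all_algebra.
From mathcomp Require Import mpoly.

Set Implicit Arguments.
Unset Strict Implicit.
Unset Printing Implicit Defensive.

Import Order.TTheory GRing.Theory Num.Theory.
Local Open Scope ring_scope.

(* A graph G with vertices 'I_n (v_1..v_n) and edges 'I_m (e_1..e_m);
   edge i is the unordered pair {(e i).1, (e i).2}. *)

Section Graph.
Variables (n m : nat) (e : 'I_m -> 'I_n * 'I_n).

Definition edge_is (i : 'I_m) (x y : 'I_n) : bool :=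
  ((e i == (x, y)) || (e i == (y, x))).

Definition simple_graph : Prop :=
  (forall i, (e i).1 != (e i).2) /\
  (forall i j, edge_is j (e i).1 (e i).2 -> i = j).

Definition adj : rel 'I_n := fun x y => [exists i, edge_is i x y].

Definition connected_graph : Prop := forall x y : 'I_n, connect adj x y.

Definition in_pairs (es : seq ('I_n * 'I_n)) (x y : 'I_n) : bool :=
  ((x, y) \in es) || ((y, x) \in es).

Definition cycle_edges (c : seq 'I_n) := zip c (rot 1 c).
Definition path_edges (q : seq 'I_n) := zip q (behead q).

(* G has an induced subgraph consisting of two vertex-disjoint odd cycles
   C1 = (a :: c1), C2 = (b :: c2) joined by a path a :: q of length
   size q >= 1, from the vertex a of C1 (wlog the head, cycles being
   rotation-invariant) to the vertex b = last a q of C2, whose internal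
   vertices lie outside the cycles; "induced" means that two vertices of
   C1 u C2 u path are adjacent in G iff they are consecutive on C1, on C2 or
   on the path. *)
Definition two_odd_cycles_joined (a : 'I_n) (c1 : seq 'I_n) (b : 'I_n) (c2 q : seq 'I_n) : Prop :=
  uniq (a :: c1) /\ uniq (b :: c2) /\ uniq (a :: q) /\
  ((2 <= size c1)%N /\ ~~ odd (size c1)) /\
  ((2 <= size c2)%N /\ ~~ odd (size c2)) /\
  ((1 <= size q)%N /\ last a q = b) /\
  [disjoint (a :: c1) & (b :: c2)] /\
  (forall v, v \in take (size q).-1 q -> (v \notin a :: c1) && (v \notin b :: c2)) /\
  {in (a :: c1) ++ (b :: c2) ++ (a :: q) &, forall x y,
      adj x y = in_pairs (cycle_edges (a :: c1) ++ cycle_edges (b :: c2) ++ path_edges (a :: q)) x y}.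

Definition sharp_condition : Prop :=
  ~ exists a c1 b c2 q, two_odd_cycles_joined a c1 b c2 q.

Variable K : fieldType.

Definition toric_map (f : {mpoly K[m]}) : {mpoly K[n]} :=
  f \mPo [tuple ('X_(e i).1 * 'X_(e i).2 : {mpoly K[n]}) | i < m].

Definition toric_ideal : pred {mpoly K[m]} := fun f => toric_map f == 0.

Definition binpoly (b : 'X_{1..m} * 'X_{1..m}) : {mpoly K[m]} :=
  'X_[b.1] - 'X_[b.2].

Definition in_ideal (gs : seq {mpoly K[m]}) (f : {mpoly K[m]}) : Prop :=
  exists cs : seq {mpoly K[m]}, f = \sum_(i < size gs) cs`_i * gs`_i.

Definition binomial_gen_system (S : seq ('X_{1..m} * 'X_{1..m})) : Prop :=
  (forall b, b \in S -> toric_ideal (binpoly b)) /\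
  (forall f, toric_ideal f -> in_ideal (map binpoly S) f).

Definition minimal_binomial_gen_system (S : seq ('X_{1..m} * 'X_{1..m})) : Prop :=
  binomial_gen_system S /\ uniq S /\
  (forall b, b \in S -> ~ binomial_gen_system (rem b S)).

Definition minimal_binomial (f : {mpoly K[m]}) : Prop :=
  exists S, minimal_binomial_gen_system S /\ f \in map binpoly S.

Definition indispensable_monomial (M : 'X_{1..m}) : Prop :=
  forall S, binomial_gen_system S ->
    exists2 b, b \in S & (b.1 != b.2) && ((b.1 == M) || (b.2 == M)).

(* mu(I): cardinality of a minimal binomial generating set, i.e. the least
   size of a system of binomial generators *)
Definition is_mu (k : nat) : Prop :=
  (exists S, binomial_gen_system S /\ size S = k) /\
  (forall S, binomial_gen_system S -> (k <= size S)%N).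

Definition binomial_rad_gen (S : seq ('X_{1..m} * 'X_{1..m})) : Prop :=
  (forall b, b \in S -> toric_ideal (binpoly b)) /\
  (forall f, toric_ideal f -> exists k : nat, in_ideal (map binpoly S) (f ^+ k)).

Definition is_bar (k : nat) : Prop :=
  (exists S, binomial_rad_gen S /\ size S = k) /\
  (forall S, binomial_rad_gen S -> (k <= size S)%N).

Definition even_closed_walk (w : seq 'I_m) : Prop :=
  (0 < size w)%N /\ ~~ odd (size w) /\
  exists (v0 : 'I_n) (vs : seq 'I_n),
     [/\ size vs = size w, last v0 vs = v0 &
          all (fun t => edge_is t.1 t.2.1 t.2.2) (zip w (zip (v0 :: vs) vs))].

(* exponents of B_w^(+) = prod x_{i_1} x_{i_3} ..., B_w^(-) = prod x_{i_2} x_{i_4} ...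
   (0-based position p of the walk: p even <-> 1-based odd) *)
Definition walk_exp (w : seq 'I_m) (par : bool) : 'X_{1..m} :=
  [multinom count (fun p => (odd p.2 == par) && (p.1 == i)) (zip w (iota 0 (size w))) | i < m].

Definition Bw_plus (w : seq 'I_m) := walk_exp w false.
Definition Bw_minus (w : seq 'I_m) := walk_exp w true.
Definition Bw (w : seq 'I_m) : {mpoly K[m]} := binpoly (Bw_plus w, Bw_minus w).

Definition squarefree (M : 'X_{1..m}) : bool := [forall i, (M i <= 1)%N].

Definition in_kerA (u : 'I_m -> int) : Prop :=
  forall v : 'I_n, \sum_(i < m | ((e i).1 == v) || ((e i).2 == v)) u i = 0.

Definition supp (u : 'I_m -> int) : {set 'I_m} := [set i | u i != 0].

(* x^a - x^b is a circuit: a = u_+, b = u_- for u in ker_Z(A) nonzero with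
   inclusion-minimal support and relatively prime coordinates *)
Definition is_circuit (a b : 'X_{1..m}) : Prop :=
  let u := fun i => (a i)%:Z - (b i)%:Z in
  [/\ (forall i, (a i == 0%N) || (b i == 0%N)),
      (exists i, u i != 0),
      in_kerA u,
      (forall v, in_kerA v -> (exists i, v i != 0) -> ~ (supp v \proper supp u))
    & (\big[gcdn/0%N]_(i < m) `|u i|%N = 1)%N].

End Graph.

(* Main.v *)
(* Monomials are multisets of edges, and the fibers are the sets of monomials with
   the same degree sequence. Modulo generators of smaller degree, two monomials
   of a fiber are connected when they share a variable, so a set S of binomials
   generates the ideal iff every fiber is connected by sharing and by S.

   If M and N lie in different components of a fiber, then M - N is primitive and
   is carried by an alternating closed walk w, and every other edge joining two
   vertices of w at odd distance along w would connect M to N. Hence two vertices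
   visited twice by w would be cut vertices separating two odd closed walks, and
   breadth-first search from one of them would produce an induced pair of odd
   cycles joined by a path. By (#) at most one vertex is visited twice, so M and N
   are squarefree, M - N is a circuit B_w, and by hypothesis one of M, N is
   indispensable. A parity argument on chords then shows that a set of binomials
   involving every indispensable monomial connects all fibers: three components
   can only occur in a fiber of degree 2.

   Let S generate the radical. For an indispensable M, evaluation at the indicator
   of supp M shows that S contains a nontrivial binomial one of whose monomials has
   support supp M; if both supports of this binomial come from indispensable
   monomials, these lie in the same fiber. Replacing each such binomial by one
   involving the indispensable monomials themselves gives a generating system with
   no more elements than S. *)

Require Import Defs.
From HB Require Import structures.
From mathcomp Require Import all_boot all_order all_algebra.
From mathcomp Require Import mpoly zify.
From Stdlib Require Import Classical.

Set Implicit Arguments.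
Unset Strict Implicit.
Unset Printing Implicit Defensive.

(** * Fibers and alternating closed walks *)

Section Combinatorics.
Variables (n m : nat) (e : 'I_m -> 'I_n * 'I_n).

Implicit Types (M N X Y Z : 'X_{1..m}) (S : seq ('X_{1..m} * 'X_{1..m})).

(** The exponent of the image of ['X_[M]] under the toric map, so that the fibers are the level sets
    of [degA]. *)
Definition degA M : 'X_{1..n} :=
  (\sum_(i < m) (U_((e i).1) + U_((e i).2)) *+ M i)%MM.

Lemma degAE M v :
  degA M v = \sum_(i < m) (((e i).1 == v) + ((e i).2 == v)) * M i.
Proof.
by rewrite mnm_sumE; apply: eq_bigr => i _; rewrite mulmnE mnmDE !mnm1E.
Qed.

Lemma degAD M N : degA (M + N)%MM = (degA M + degA N)%MM.
Proof.
apply/mnmP => v; rewrite mnmDE !degAE -big_split /=.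
by apply: eq_bigr => i _; rewrite mnmDE mulnDr.
Qed.

Lemma degA0 : degA 0%MM = 0%MM.
Proof. by apply/mnmP => v; rewrite degAE mnm0E big1 // => i _; rewrite mnm0E muln0. Qed.

Lemma degAU i : degA U_(i)%MM = (U_((e i).1) + U_((e i).2))%MM.
Proof.
apply/mnmP => v; rewrite degAE mnmDE !mnm1E (bigD1 i) //= mnm1E eqxx muln1.
by rewrite big1 ?addn0 // => j ji; rewrite mnm1E [i == j]eq_sym (negPf ji) muln0.
Qed.

Lemma degAD_eval M N v : degA (M + N)%MM v = degA M v + degA N v.
Proof. by rewrite degAD mnmDE. Qed.

Lemma mdeg_degA M : mdeg (degA M) = (mdeg M).*2.
Proof.
rewrite /degA mdeg_sum mdegE -muln2 big_distrl /=.
by apply: eq_bigr => i _; rewrite mdegMn mdegD !mdeg1 mulnC.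
Qed.

Lemma degA_mdeg M N : degA M = degA N -> mdeg M = mdeg N.
Proof. by move=> h; apply: double_inj; rewrite -!mdeg_degA h. Qed.

Lemma degA_eq0 M : degA M = 0%MM -> M = 0%MM.
Proof.
by move=> h; apply/eqP; rewrite -mdeg_eq0 -double_eq0 -mdeg_degA h mdeg0.
Qed.

Lemma edge_isC i x y : edge_is e i x y = edge_is e i y x.
Proof. by rewrite /edge_is orbC. Qed.

Lemma degA_edge i x y : edge_is e i x y -> degA U_(i)%MM = (U_(x) + U_(y))%MM.
Proof. by rewrite degAU => /orP[] /eqP -> //=; rewrite addmC. Qed.

Lemma degA_edgeE i x y v : edge_is e i x y ->
  degA U_(i)%MM v = (x == v) + (y == v).
Proof. by move/degA_edge->; rewrite mnmDE !mnm1E. Qed.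

Lemma mnm_neq0P M : reflect (exists i, 0 < M i) (M != 0%MM).
Proof.
apply: (iffP idP) => [nz | [i Mi]].
  apply: NNPP => nex; case/eqP: nz; apply/mnmP => i; rewrite mnm0E.
  by apply/eqP; rewrite -leqn0 leqNgt; apply/negP => Mi; case: nex; exists i.
by apply: contraTneq Mi => ->; rewrite mnm0E.
Qed.

Lemma mnm_split M i : 0 < M i -> exists M', M = (U_(i) + M')%MM.
Proof. by move=> h; exists (M - U_(i))%MM; rewrite addmC submK // lep1mP -lt0n. Qed.

Lemma degA_gt0 M i : 0 < M i -> 0 < degA M (e i).1 /\ 0 < degA M (e i).2.
Proof.
case/mnm_split=> M' ->; rewrite !degAD_eval degAU !mnmDE !mnm1E !eqxx; lia.
Qed.

Lemma degA_gt0_edge M i x y : edge_is e i x y -> 0 < M i -> 0 < degA M x.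
Proof. by move=> /orP[] /eqP h /degA_gt0; rewrite h /=; case. Qed.

Definition share M N := exists i, (0 < M i) && (0 < N i).

(* With S empty, the classes of a fiber modulo the binomials of smaller degree. *)
Inductive conn S : 'X_{1..m} -> 'X_{1..m} -> Prop :=
| conn_refl M : conn S M M
| conn_step M N P : (degA M = degA N /\ share M N) \/ ((M, N) \in S) || ((N, M) \in S) ->
    conn S N P -> conn S M P.

Lemma conn_trans S M N P : conn S M N -> conn S N P -> conn S M P.
Proof. by elim=> // {}M {}N Q st _ IH /IH; apply: conn_step. Qed.

Lemma conn_share S M N i : degA M = degA N -> 0 < M i -> 0 < N i -> conn S M N.
Proof.
move=> d h1 h2; apply: (@conn_step _ _ N); last exact: conn_refl.
by left; split=> //; exists i; rewrite h1.
Qed.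

Lemma conn_mem S M N : (M, N) \in S -> conn S M N.
Proof. by move=> h; apply: (@conn_step _ _ N); [right; rewrite h | apply: conn_refl]. Qed.

Lemma conn_sym S M N : conn S M N -> conn S N M.
Proof.
elim=> [P|{}M {}N P st _ IH]; first exact: conn_refl.
apply: (conn_trans IH); apply: conn_step (conn_refl _ _).
case: st => [[d [i h]]|h]; [left | right; by rewrite orbC].
by split=> //; exists i; rewrite andbC.
Qed.

Lemma conn_sub S S' M N : {subset S <= S'} -> conn S M N -> conn S' M N.
Proof.
move=> sub; elim=> [P|{}M {}N P st _ IH]; first exact: conn_refl.
apply: conn_step IH; case: st => [|/orP[/sub|/sub] ->]; [by left | right.. ] => //.
by rewrite orbT.
Qed.

Lemma conn0_sub S M N : conn [::] M N -> conn S M N.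
Proof. exact: conn_sub. Qed.

(** Primitivity in the sense of Graver bases, phrased with divisors [X] of [M] and [Y] of [N]; the
    case where [M = N] is a single variable is not excluded. *)
Definition prim M N :=
  [/\ degA M = degA N, M != 0%MM &
   forall X X' Y Y', M = (X + X')%MM -> N = (Y + Y')%MM -> degA X = degA Y ->
     X != 0%MM -> X' = 0%MM /\ Y' = 0%MM].

Lemma degA_neq0 M N : degA M = degA N -> M != 0%MM -> N != 0%MM.
Proof.
move=> d; apply: contraNneq => N0; apply/eqP/degA_eq0.
by rewrite d N0 degA0.
Qed.

Lemma prim_sym M N : prim M N -> prim N M.
Proof.
case=> d nz h; split; [by [] | exact: degA_neq0 nz |].
move=> X X' Y Y' eN eM dXY Xnz.
have [] := h _ _ _ _ eM eN (esym dXY) (degA_neq0 dXY Xnz); by split.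
Qed.

(** For a balanced pair [X], [Y] with [X'] nonzero, the monomial [Y + X'] lies in the fiber, shares
    [X'] with [M] and [Y] with [N], and so connects them. *)
Lemma nconn_prim M N : degA M = degA N -> ~ conn [::] M N -> prim M N.
Proof.
move=> d nc; split=> //.
  apply: contra_notN nc => /eqP M0.
  suff ->: N = M by exact: conn_refl.
  by rewrite M0; apply: degA_eq0; rewrite -d M0 degA0.
move=> X X' Y Y' eM eN dXY Xnz.
have X'0 : X' = 0%MM.
  apply/eqP; apply: contra_notT nc => /mnm_neq0P[i Xi].
  have /mnm_neq0P[j Yj] := degA_neq0 dXY Xnz.
  apply: (@conn_trans _ _ (Y + X')%MM).
    apply: (@conn_share _ _ _ i); rewrite ?eM ?mnmDE; try lia.
    by rewrite !degAD dXY.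
  apply: (@conn_share _ _ _ j); rewrite ?eN ?mnmDE; try lia.
  by rewrite -eN -d eM !degAD dXY.
split=> //; apply: degA_eq0.
apply: (@addmI _ (degA Y)).
by rewrite -degAD -eN -d eM X'0 !addm0.
Qed.

(** The edges used at the times of parity [c] in [[a, b)]. Over one period of an alternating walk
    the even times give [M] and the odd times give [N]. *)
Definition seg (c : bool) (g : nat -> 'I_m) (a b : nat) : 'X_{1..m} :=
  (\sum_(a <= t < b | odd t == c) U_(g t))%MM.

Lemma seg_nil c g a : seg c g a a = 0%MM.
Proof. by rewrite /seg big_geq. Qed.

Lemma seg_recr c g a b : a <= b ->
  seg c g a b.+1 = (seg c g a b + if odd b == c then U_(g b) else 0)%MM.
Proof.
move=> ab; rewrite /seg big_mkcond big_nat_recr //= -big_mkcond /=.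
by [].
Qed.

Lemma seg_cat c g b a d : a <= b <= d -> seg c g a d = (seg c g a b + seg c g b d)%MM.
Proof. by case/andP=> ab bd; rewrite /seg (big_cat_nat (n := b)). Qed.

Lemma seg_gt0 c g a b t : a <= t < b -> odd t = c -> 0 < seg c g a b (g t).
Proof.
move=> /andP[h1 h2] o; rewrite (@seg_cat _ _ t) ?h1 ?(ltnW h2) //.
rewrite (@seg_cat _ _ t.+1 t) ?leqnSn //.
by rewrite seg_recr // seg_nil o eqxx !mnmDE mnm1E eqxx; lia.
Qed.

Lemma seg_gt0P c g a b i : 0 < seg c g a b i ->
  exists t, [/\ a <= t < b, odd t = c & g t = i].
Proof.
rewrite /seg mnm_sumE => h; apply: NNPP => nex.
move: h; rewrite big1_seq // => t /andP[/eqP o]; rewrite mem_index_iota => ab.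
by rewrite mnm1E; case: eqP => // gt; case: nex; exists t.
Qed.

Lemma seg_neq0 c g a b t : a <= t < b -> odd t = c -> seg c g a b != 0%MM.
Proof. by move=> h o; apply/mnm_neq0P; exists (g t); exact: seg_gt0. Qed.

(* The alternating sum of the degrees telescopes; the terms are moved so that no
   subtraction occurs. *)
Lemma seg_deg (x : nat -> 'I_n) g a b v : a <= b ->
  (forall t, a <= t < b -> edge_is e (g t) (x t) (x t.+1)) ->
  degA (seg false g a b) v + odd a * (x a == v) + ~~ odd b * (x b == v) =
  degA (seg true g a b) v + ~~ odd a * (x a == v) + odd b * (x b == v).
Proof.
move=> ab; elim: b ab => [|b IH] ab he.
  by rewrite (_ : a = 0) ?seg_nil; lia.
move: ab; rewrite leq_eqVlt ltnS => /orP[/eqP <-|ab]; first by rewrite !seg_nil; lia.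
have {}IH := IH ab (fun t h => he t ltac:(lia)).
have eb := degA_edgeE v (he b ltac:(lia)).
rewrite !seg_recr // !degAD_eval /=.
move: IH; case: (boolP (odd b)) => ob /= IH; rewrite ?degA0 ?mnm0E eb; lia.
Qed.

(* The walk is periodic over nat, so that it can be restarted at any vertex;
   restarting at an odd time exchanges M and N. *)
Record alt_walk M N (x : nat -> 'I_n) (g : nat -> 'I_m) (L : nat) : Prop := AltWalk {
  aw_edge : forall t, edge_is e (g t) (x t) (x t.+1);
  aw_x : forall t, x (t + L) = x t;
  aw_g : forall t, g (t + L) = g t;
  aw_even : ~~ odd L;
  aw_pos : 0 < L;
  aw_M : M = seg false g 0 L;
  aw_N : N = seg true g 0 L }.

Lemma seg_shift1 c g a b : seg c (fun t => g t.+1) a b = seg (~~ c) g a.+1 b.+1.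
Proof. by rewrite /seg [RHS]big_add1 /=; apply: eq_bigl => t; case: (odd t) c => -[]. Qed.

Lemma seg_rot c g L : ~~ odd L -> g L = g 0 -> seg c g 1 L.+1 = seg c g 0 L.
Proof.
case: L => [|L] oL gL; first by rewrite !seg_nil.
rewrite (@seg_recr _ _ 1) // (@seg_cat _ _ 1 0) // addmC; congr (_ + _)%MM.
by rewrite seg_recr // seg_nil add0m gL (negPf oL).
Qed.

Lemma alt_walk_shift1 M N x g L : alt_walk M N x g L ->
  alt_walk N M (fun t => x t.+1) (fun t => g t.+1) L.
Proof.
case=> h1 h2 h3 h4 h5 h6 h7; split=> // [t|t||].
- by rewrite -addSn h2.
- by rewrite -addSn h3.
- by rewrite seg_shift1 /= seg_rot //; exact: (h3 0).
- by rewrite seg_shift1 /= seg_rot //; exact: (h3 0).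
Qed.

Lemma alt_walk_shift M N x g L a : alt_walk M N x g L ->
  alt_walk (if odd a then N else M) (if odd a then M else N)
           (fun t => x (a + t)) (fun t => g (a + t)) L.
Proof.
elim: a M N x g => [|a IH] M N x g w; first exact: w.
by have := IH _ _ _ _ (alt_walk_shift1 w); rewrite /=; case: (odd a).
Qed.

End Combinatorics.

(** * Primitive pairs are carried by alternating closed walks *)

Section Walks.
Variables (n m : nat) (e : 'I_m -> 'I_n * 'I_n).
Implicit Types (M N X Y Z : 'X_{1..m}) (S : seq ('X_{1..m} * 'X_{1..m})).

Lemma degA_gt0P M v : 0 < degA e M v -> exists i y, 0 < M i /\ edge_is e i v y.
Proof.
rewrite degAE => h; apply: NNPP => nex; move: h.
rewrite big1 // => i _; apply/eqP; rewrite muln_eq0 orbC -implyNb -lt0n.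
apply/implyP => Mi; apply: contra_notT nex; rewrite addn_eq0 negb_and.
case/orP; rewrite eqb0 negbK => /eqP <-.
  by exists i, (e i).2; split; rewrite // /edge_is -surjective_pairing eqxx.
by exists i, (e i).1; split; rewrite // /edge_is -surjective_pairing eqxx orbT.
Qed.

Lemma seg_ext c (g g' : nat -> 'I_m) a b : (forall t, a <= t < b -> g t = g' t) ->
  seg c g a b = seg c g' a b.
Proof. by move=> h; apply: congr_big_nat => // t /andP[_ /h ->]. Qed.

Lemma trail_close M N s k x g M' N' : prim e M N ->
  mdeg M' + mdeg N' < s -> 0 < k ->
  (forall t, t < k -> edge_is e (g t) (x t) (x t.+1)) ->
  M = (seg false g 0 k + M')%MM -> N = (seg true g 0 k + N')%MM ->
  exists x g L, [/\ 0 < L, ~~ odd L, x L = x 0,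
    (forall t, t < L -> edge_is e (g t) (x t) (x t.+1)) &
    M = seg false g 0 L /\ N = seg true g 0 L].
Proof.
move=> pr; elim: s k x g M' N' => [//|s IH] k x g M' N' hs k0 he eM eN.
have [d _ pr'] := pr.
have tel v := seg_deg v (leq0n k) (fun t (ht : 0 <= t < k) => he t ht).
have dv v : degA e (seg false g 0 k) v + degA e M' v = degA e (seg true g 0 k) v + degA e N' v.
  by rewrite -!degAD_eval -eM -eN d.
have ext f y : edge_is e f (x k) y ->
    let g' t := if t < k then g t else f in
    let x' t := if t <= k then x t else y in
    [/\ forall t, t < k.+1 -> edge_is e (g' t) (x' t) (x' t.+1),
     forall c, seg c g' 0 k = seg c g 0 k & g' k = f].
  move=> hf g' x'; split; last by rewrite /g' ltnn.
    move=> t; rewrite ltnS leq_eqVlt /g' /x' => /orP[/eqP ->|tk].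
      by rewrite !ltnn leqnn.
    by rewrite tk (ltnW tk) he.
  by move=> c; apply: seg_ext => t /andP[_ tk]; rewrite /g' tk.
have [ok|ok] := boolP (odd k).
  have [|f [y [Nf hf]]] := @degA_gt0P N' (x k).
    by move: (tel (x k)) (dv (x k)); rewrite ok !eqxx /=; lia.
  have [N'' eN''] := mnm_split Nf.
  have [he' hseg hk] := ext _ _ hf.
  apply: (IH k.+1 _ _ M' N'' _ _ he') => //.
  - by move: hs; rewrite eN'' mdegD mdeg1; lia.
  - by rewrite seg_recr // ok hseg eM addm0.
  - by rewrite seg_recr // ok hseg eN hk eqxx -addmA eN''.
(* After an even number of steps the trail is either back at its start, hence balanced, or has used
   more edges of [N] than of [M] at its endpoint. *)
have [xk|xk] := eqVneq (x k) (x 0).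
  have dXY : degA e (seg false g 0 k) = degA e (seg true g 0 k).
    apply/mnmP => v; move: (tel v); rewrite xk (negPf ok) /=; lia.
  have nz : seg false g 0 k != 0%MM by apply: (@seg_neq0 _ _ _ _ _ 0).
  have [M0 N0] := pr' _ _ _ _ eM eN dXY nz.
  by exists x, g, k; split=> //; rewrite eM eN M0 N0 !addm0.
have [|f [y [Mf hf]]] := @degA_gt0P M' (x k).
  move: (tel (x k)) (dv (x k)); rewrite (negPf ok) eqxx [x 0 == _]eq_sym (negPf xk) /=; lia.
have [M'' eM''] := mnm_split Mf.
have [he' hseg hk] := ext _ _ hf.
apply: (IH k.+1 _ _ M'' N' _ _ he') => //.
- by move: hs; rewrite eM'' mdegD mdeg1; lia.
- by rewrite seg_recr // (negPf ok) hseg eM hk eqxx -addmA eM''.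
- by rewrite seg_recr // (negPf ok) hseg eN addm0.
Qed.

Lemma prim_walk M N : prim e M N -> exists x g L, alt_walk e M N x g L.
Proof.
move=> pr; have [_ /mnm_neq0P[f Mf] _] := pr; have [M' eM] := mnm_split Mf.
pose x t := if t == 0 then (e f).1 else (e f).2.
have [| // | | | |x0 [g0 [L [L0 oL xL he [eM0 eN0]]]]] :=
    @trail_close M N (mdeg M' + mdeg N).+1 1 x (fun _ => f) M' N pr.
- by [].
- by case=> // _; rewrite /edge_is -surjective_pairing eqxx.
- by rewrite seg_recr // seg_nil add0m.
- by rewrite seg_recr // seg_nil /= !add0m.
(* Reducing times modulo [L] turns the closed trail into a periodic walk. *)
exists (fun t => x0 (t %% L)), (fun t => g0 (t %% L)), L.
have sg c : seg c (fun t => g0 (t %% L)) 0 L = seg c g0 0 L.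
  by apply: seg_ext => t /andP[_ tL]; rewrite modn_small.
split=> // [t|t|t||]; rewrite ?sg ?modnDr //.
have tL := ltn_pmod t L0; have := he _ tL.
suff -> : x0 (t.+1 %% L) = x0 (t %% L).+1 by [].
rewrite -addn1 -modnDml addn1.
move: tL; rewrite leq_eqVlt => /orP[/eqP ->|tL]; first by rewrite modnn xL.
by rewrite modn_small.
Qed.

End Walks.

(** * Returns and chords of an alternating walk *)

Section WalkGeometry.
Variables (n m : nat) (e : 'I_m -> 'I_n * 'I_n).
Hypothesis noloop : forall i, (e i).1 != (e i).2.
Implicit Types (M N X Y Z P Q : 'X_{1..m}) (x : nat -> 'I_n) (g : nat -> 'I_m).

Lemma edge_neq f u v : edge_is e f u v -> u != v.
Proof. by move=> /orP[] /eqP h; have := noloop f; rewrite h // eq_sym. Qed.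

Lemma aw_seg_deg M N x g L a b v : alt_walk e M N x g L -> a <= b ->
  degA e (seg false g a b) v + odd a * (x a == v) + ~~ odd b * (x b == v) =
  degA e (seg true g a b) v + ~~ odd a * (x a == v) + odd b * (x b == v).
Proof. by move=> w ab; apply: seg_deg => // t _; exact: aw_edge w t. Qed.

Lemma aw_xL M N x g L : alt_walk e M N x g L -> x L = x 0.
Proof. by move=> w; have := aw_x w 0. Qed.

(** A return after an even time would cut off a proper balanced closed subwalk, against
    primitivity. *)
Lemma even_return M N x g L j : prim e M N -> alt_walk e M N x g L ->
  0 < j < L -> x 0 = x j -> odd j.
Proof.
move=> [_ _ pr] w /andP[j0 jL] xj; apply: contraT => oj.
have d : degA e (seg false g 0 j) = degA e (seg true g 0 j).
  by apply/mnmP => v; have := aw_seg_deg v w (leq0n j); rewrite (negPf oj) -xj /=; lia.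
have cut : 0 <= j <= L by lia.
have [|/eqP + _] := pr _ _ _ _ (etrans (aw_M w) (seg_cat _ _ cut)) (etrans (aw_N w) (seg_cat _ _ cut)) d.
  exact: (@seg_neq0 _ _ _ _ _ 0).
by rewrite (negPf (@seg_neq0 _ _ _ _ _ j _ _)) ?(negPf oj) // leqnn jL.
Qed.

Lemma even_return_at M N x g L i j : prim e M N -> alt_walk e M N x g L ->
  i < j < i + L -> x i = x j -> odd (j - i).
Proof.
move=> pr w ij xij; have w' := alt_walk_shift i w.
apply: (even_return _ w'); [|lia|by rewrite addn0 subnKC //; lia].
by case: (odd i) => //; exact: prim_sym.
Qed.

(** All three return times would be odd, while one is the sum of the other two. *)
Lemma three_visits M N x g L i j k : prim e M N -> alt_walk e M N x g L ->
  i < j < k -> k < i + L -> x i = x j -> x j = x k -> False.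
Proof.
move=> pr w ijk kL xij xjk.
have o1 := even_return_at pr w (ltac:(lia) : i < j < i + L) xij.
have o2 := even_return_at pr w (ltac:(lia) : j < k < j + L) xjk.
have o3 := even_return_at pr w (ltac:(lia) : i < k < i + L) (etrans xij xjk).
lia.
Qed.

Lemma seg_cat4 c g i t j L : i <= t <= j -> j <= L ->
  seg c g 0 L = (seg c g 0 i + seg c g t j + (seg c g i t + seg c g j L))%MM.
Proof.
move=> itj jL; rewrite (@seg_cat _ _ _ i) 1?(@seg_cat _ _ _ t i) 1?(@seg_cat _ _ _ j t); try lia.
by apply/mnmP => k; rewrite !mnmDE; lia.
Qed.

(* Otherwise the arcs between the two double vertices recombine into a shorter
   balanced closed walk. *)
Lemma no_interlace M N x g L i t j : prim e M N -> alt_walk e M N x g L ->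
  0 < i < t -> t < j < L -> x 0 = x t -> x i = x j -> False.
Proof.
move=> pr w it tj xt xij.
have ot := even_return pr w (ltac:(lia) : 0 < t < L) xt.
have oij := even_return_at pr w (ltac:(lia) : i < j < i + L) xij.
case: pr => _ _ pr.
have d : degA e (seg false g 0 i + seg false g t j)%MM =
         degA e (seg true g 0 i + seg true g t j)%MM.
  apply/mnmP => v; rewrite !degAD_eval.
  have := aw_seg_deg v w (leq0n i); have := aw_seg_deg v w (ltac:(lia) : t <= j).
  have oj : odd j = ~~ odd i by lia.
  by rewrite ot -xt -xij oj /=; lia.
have c1 : i <= t <= j by lia.
have c2 : j <= L by lia.
have [|/eqP + /eqP] := pr _ _ _ _ (etrans (aw_M w) (seg_cat4 _ _ c1 c2))
    (etrans (aw_N w) (seg_cat4 _ _ c1 c2)) d.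
  rewrite mnmD_eq0 negb_and (@seg_neq0 _ _ _ _ _ 0) //; lia.
rewrite !mnmD_eq0 => /andP[h1 _] /andP[h2 _].
case: (boolP (odd i)) => oi.
  by move: h2; rewrite (negPf (@seg_neq0 _ _ _ _ _ i _ _)) //; lia.
by move: h1; rewrite (negPf (@seg_neq0 _ _ _ _ _ i _ _)) ?(negPf oi) //; lia.
Qed.

Lemma conn_via M N Z a b :
  degA e M = degA e N -> degA e Z = degA e M ->
  0 < M a -> 0 < Z a -> 0 < Z b -> 0 < N b -> conn e [::] M N.
Proof.
move=> d dZ Ma Za Zb Nb; apply: (@conn_trans _ _ _ _ _ Z).
  exact: (@conn_share _ _ _ _ _ _ a).
by apply: (@conn_share _ _ _ _ _ _ b); rewrite // dZ.
Qed.

Lemma aw_gt0 M N x g L t : alt_walk e M N x g L -> t < L ->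
  0 < (if odd t then N else M) (g t).
Proof.
by move=> w tL; case: (boolP (odd t)) => ot; rewrite ?(aw_M w) ?(aw_N w);
  apply: seg_gt0; rewrite ?(negPf ot).
Qed.

(** The chord closes the arc from [0] to [j] to an even closed walk. Exchanging the even edges of
    [M] on this arc for its odd edges and [f] gives a monomial of the fiber that meets both [M] and
    [N], unless one of the two arcs is a single edge. *)
Lemma odd_chord M N x g L j f : degA e M = degA e N -> ~ conn e [::] M N ->
  alt_walk e M N x g L -> 0 < j < L -> odd j -> edge_is e f (x 0) (x j) ->
  j = 1 \/ j = L.-1.
Proof.
move=> d nc w j0L oj hf; apply: NNPP => h; apply: nc.
have oL := aw_even w.
have eM : M = (seg false g 0 j + seg false g j L)%MM by rewrite (aw_M w); apply: seg_cat; lia.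
have eN : N = (seg true g 0 j + seg true g j L)%MM by rewrite (aw_N w); apply: seg_cat; lia.
have s1 : 0 < seg false g j L (g j.+1) by apply: seg_gt0; rewrite /= ?oj //; lia.
have s2 : 0 < seg true g 0 j (g 1) by apply: seg_gt0; rewrite //; lia.
apply: (@conn_via _ _ (seg true g 0 j + seg false g j L + U_(f))%MM (g j.+1) (g 1)) => //;
  rewrite ?eM ?eN ?mnmDE; try lia.
apply/mnmP => v; rewrite !degAD_eval (degA_edgeE v hf).
have := aw_seg_deg v w (leq0n j); rewrite oj /=; lia.
Qed.

(** The arcs [0..i] and [t..j] meet at the double vertex and form an even closed walk with the
    chord. Exchanging edges along it gives a monomial of the fiber that meets both [M] and [N]. *)
Lemma no_chord_across M N x g L i t j f : degA e M = degA e N -> ~ conn e [::] M N ->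
  alt_walk e M N x g L -> 0 < i < t -> t < j < L -> x 0 = x t ->
  odd i = odd j -> edge_is e f (x i) (x j) -> False.
Proof.
move=> d nc w it tj xt oij hf; have pr := nconn_prim d nc; apply: nc.
have ot := even_return pr w (ltac:(lia) : 0 < t < L) xt.
have oL := aw_even w.
have eM : M = _ := etrans (aw_M w) (seg_cat4 false g (ltac:(lia) : i <= t <= j) (ltac:(lia) : j <= L)).
have eN : N = _ := etrans (aw_N w) (seg_cat4 true g (ltac:(lia) : i <= t <= j) (ltac:(lia) : j <= L)).
have tel v := conj (aw_seg_deg v w (leq0n i)) (aw_seg_deg v w (ltac:(lia) : t <= j)).
case: (boolP (odd i)) => oi.
  have s1 : 0 < seg false g i t (g i.+1) by apply: seg_gt0; rewrite /= ?oi //; lia.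
  have s2 : 0 < seg true g t j (g t) by apply: seg_gt0; rewrite //; lia.
  apply: (@conn_via _ _ (seg true g 0 i + seg true g t j + (seg false g i t + seg false g j L)
             + U_(f))%MM (g i.+1) (g t)) => //; rewrite ?eM ?eN ?mnmDE; try lia.
  apply/mnmP => v; rewrite !degAD_eval (degA_edgeE v hf).
  by have [] := tel v; rewrite -oij oi ot xt /=; lia.
have s1 : 0 < seg true g j L (g j.+1) by apply: seg_gt0; rewrite /= -?oij ?oi //; lia.
have s2 : 0 < seg false g 0 i (g 0) by apply: seg_gt0; rewrite //; lia.
apply: (@conn_via _ _ (seg false g 0 i + seg false g t j + (seg true g i t + seg true g j L)
           + U_(f))%MM (g 0) (g j.+1)) => //; rewrite ?d ?eN ?mnmDE; try lia;
  last by rewrite eM !mnmDE; lia.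
apply/mnmP => v; rewrite !degAD_eval (degA_edgeE v hf).
by have [] := tel v; rewrite -oij (negPf oi) ot xt /=; lia.
Qed.

(** Two interlaced chords of different parity allow one to combine edges of [M] on two arcs with
    edges of [N] on the other two. As [M] and [N] are alone in their components, the result [Z] can
    contain no edge of either, which leaves one edge on each of the four arcs. *)
Lemma cross_chords M N x g L s t u f h : degA e M = degA e N ->
  (forall Z, conn e [::] M Z -> Z = M) -> (forall Z, conn e [::] N Z -> Z = N) ->
  alt_walk e M N x g L -> 0 < s < t -> t < u < L -> odd s -> ~~ odd t -> odd u ->
  edge_is e f (x 0) (x t) -> edge_is e h (x s) (x u) -> M f = 0 -> N f = 0 -> L = 4.
Proof.
move=> d iM iN w st tu os ot ou hf hh Mf Nf.
have oL := aw_even w.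
have eM : M = _ := etrans (aw_M w) (seg_cat4 false g (ltac:(lia) : s <= t <= u) (ltac:(lia) : u <= L)).
have eN : N = _ := etrans (aw_N w) (seg_cat4 true g (ltac:(lia) : s <= t <= u) (ltac:(lia) : u <= L)).
pose Z := (seg true g 0 s + seg true g t u + (seg false g s t + seg false g u L)
           + U_(f) + U_(h))%MM.
have Zf : 0 < Z f by rewrite !mnmDE mnm1E eqxx; lia.
have dZ : degA e M = degA e Z.
  apply/mnmP => v; rewrite eM !degAD_eval (degA_edgeE v hf) (degA_edgeE v hh).
  have := aw_seg_deg v w (leq0n s); have := aw_seg_deg v w (ltac:(lia) : t <= u).
  by rewrite os (negPf ot) ou /=; lia.
have nM i : 0 < Z i -> M i = 0.
  move=> Zi; apply/eqP; rewrite -leqn0 leqNgt; apply/negP => Mi.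
  have ZM : Z = M by apply: iM; apply: (@conn_share _ _ _ _ _ _ i).
  by rewrite ZM Mf in Zf.
have nN i : 0 < Z i -> N i = 0.
  move=> Zi; apply/eqP; rewrite -leqn0 leqNgt; apply/negP => Ni.
  have ZN : Z = N by apply: iN; apply: (@conn_share _ _ _ _ _ _ i); rewrite -?d.
  by rewrite ZN Nf in Zf.
have r1 : t = s.+1.
  apply/eqP; apply: contraT => neq.
  have sg : 0 < seg false g s t (g s.+1) by apply: seg_gt0; rewrite /= ?os //; lia.
  have := nM (g s.+1); rewrite eM !mnmDE; lia.
have r2 : L = u.+1.
  apply/eqP; apply: contraT => neq.
  have sg : 0 < seg false g u L (g u.+1) by apply: seg_gt0; rewrite /= ?ou //; lia.
  have := nM (g u.+1); rewrite eM !mnmDE; lia.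
have r3 : s = 1.
  apply/eqP; apply: contraT => neq.
  have sg : 0 < seg true g 0 s (g 1) by apply: seg_gt0 => //; lia.
  have := nN (g 1); rewrite eN !mnmDE; lia.
have r4 : u = t.+1.
  apply/eqP; apply: contraT => neq.
  have sg : 0 < seg true g t u (g t.+1) by apply: seg_gt0; rewrite /= ?ot //; lia.
  have := nN (g t.+1); rewrite eN !mnmDE; lia.
lia.
Qed.

Lemma seg_degP c (x : nat -> 'I_n) g a b v : a <= b ->
  (forall t, edge_is e (g t) (x t) (x t.+1)) ->
  0 < degA e (seg c g a b) v -> exists2 r, a <= r <= b & x r = v.
Proof.
move=> ab he /degA_gt0P[i [y [/seg_gt0P[t [tab _ gt]] hi]]].
have := he t; rewrite gt => ht; move: hi; rewrite /edge_is.
case/orP: ht => /eqP ->; rewrite !xpair_eqE.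
- case/orP=> /andP[/eqP h1 /eqP h2]; [by exists t; [lia|] | by exists t.+1; [lia|]].
- case/orP=> /andP[/eqP h1 /eqP h2]; [by exists t.+1; [lia|] | by exists t; [lia|]].
Qed.

(** The last two hypotheses say that every part of [M] or [N] that can be exchanged touches all
    vertices of the walk. A chord from the double vertex makes the edges on an arc of a single loop
    exchangeable, and this arc misses a vertex of the other loop. *)
Lemma no_covering_chord M N x g L t s f : prim e M N -> alt_walk e M N x g L ->
  0 < t < L -> x 0 = x t -> s < L -> edge_is e f (x 0) (x s) -> M f = 0 -> N f = 0 ->
  (forall P P' Q, M = (P + P')%MM -> degA e P = degA e Q -> P <> Q ->
     forall r, 0 < degA e P (x r)) ->
  (forall P P' Q, N = (P + P')%MM -> degA e P = degA e Q -> P <> Q ->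
     forall r, 0 < degA e P (x r)) -> False.
Proof.
move=> pr w t0 xt sL hf Mf Nf cM cN.
have oL := aw_even w; have he := aw_edge w.
have ot := even_return pr w t0 xt.
have ns : x 0 != x s := edge_neq hf.
have s0 : s != 0 by apply: contraNneq ns => ->.
have st : s != t by apply: contraNneq ns => ->; rewrite xt.
have t1 : t != 1 by apply: contraTneq (edge_neq (he 0)) => t1; rewrite -t1 -xt eqxx.
have tL : t.+1 != L.
  by apply: contraTneq (edge_neq (he t)) => tL; rewrite tL (aw_xL w) xt eqxx.
have t2 : x t.+1 != x 0.
  by apply/eqP => h; have := even_return pr w (ltac:(lia) : 0 < t.+1 < L) (esym h); lia.
have x1 : x 1 != x 0 by rewrite eq_sym; exact: edge_neq (he 0).
have eM a b : a <= b <= L -> exists P', M = (seg false g a b + P')%MM.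
  move=> ab; exists (seg false g 0 a + seg false g b L)%MM; rewrite (aw_M w).
  rewrite (@seg_cat _ _ _ a) 1?(@seg_cat _ _ _ b a); try lia.
  by apply/mnmP => k; rewrite !mnmDE; lia.
have eN a b : a <= b <= L -> exists P', N = (seg true g a b + P')%MM.
  move=> ab; exists (seg true g 0 a + seg true g b L)%MM; rewrite (aw_N w).
  rewrite (@seg_cat _ _ _ a) 1?(@seg_cat _ _ _ b a); try lia.
  by apply/mnmP => k; rewrite !mnmDE; lia.
have cM' a b : a <= b <= L -> (forall v, degA e (seg false g a b) v = degA e (seg true g a b + U_(f))%MM v) ->
    forall r, exists2 r', a <= r' <= b & x r' = x r.
  move=> ab d r; apply: (@seg_degP false) he _; first by lia.
  have [P' eP] := eM a b ab; apply: (cM _ _ (seg true g a b + U_(f))%MM eP); first by apply/mnmP; exact: d.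
  by move=> eq; move: Mf; rewrite eP eq !mnmDE mnm1E eqxx; lia.
have cN' a b : a <= b <= L -> (forall v, degA e (seg true g a b) v = degA e (seg false g a b + U_(f))%MM v) ->
    forall r, exists2 r', a <= r' <= b & x r' = x r.
  move=> ab d r; apply: (@seg_degP true) he _; first by lia.
  have [P' eP] := eN a b ab; apply: (cN _ _ (seg false g a b + U_(f))%MM eP); first by apply/mnmP; exact: d.
  by move=> eq; move: Nf; rewrite eP eq !mnmDE mnm1E eqxx; lia.
have no i j : 0 < i < t -> t < j < L -> x i <> x j.
  by move=> h1 h2; apply: (no_interlace pr w h1 h2 xt).
(* In the loop containing [s], take the arc of odd length between [s] and the double vertex; the end
   edges of this arc have the same parity, which decides between [M] and [N]. The missed vertex is
   [x t.+1] for the first loop and [x 1] for the second. *)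
have [st'|st'] := ltnP s t; have [os|os] := boolP (odd s).
- have [|v|r r1 r2] := cM' 0 s _ _ t.+1; first by lia.
    rewrite degAD_eval (degA_edgeE v hf).
    by have := aw_seg_deg v w (leq0n s); rewrite os /=; lia.
  have [r0|r0] := posnP r; first by move: t2; rewrite -r2 r0 eqxx.
  by apply: (no r t.+1) => //; lia.
- have [|v|r r1 r2] := cM' s t _ _ t.+1; first by lia.
    rewrite degAD_eval (degA_edgeE v hf) xt.
    by have := aw_seg_deg v w (ltnW st'); rewrite ot (negPf os) /=; lia.
  have [r0|r0] := eqVneq r t; first by move: t2; rewrite -r2 r0 xt eqxx.
  by apply: (no r t.+1) => //; lia.
- have [|v|r r1 r2] := cN' s L _ _ 1; first by lia.
    rewrite degAD_eval (degA_edgeE v hf).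
    by have := aw_seg_deg v w (ltnW sL); rewrite os (negPf oL) (aw_xL w) /=; lia.
  have [r0|r0] := eqVneq r L; first by move: x1; rewrite -r2 r0 (aw_xL w) eqxx.
  by apply: (no 1 r) => //; lia.
- have [|v|r r1 r2] := cN' t s _ _ 1; first by lia.
    rewrite degAD_eval (degA_edgeE v hf) xt.
    by have := aw_seg_deg v w st'; rewrite ot (negPf os) /=; lia.
  have [r0|r0] := eqVneq r t; first by move: x1; rewrite -r2 r0 xt eqxx.
  by apply: (no 1 r) => //; lia.
Qed.

(** Each visit to [v] is adjacent to one edge of [M] and one of [N]; the count is done for both
    together and then halved. *)
Lemma walk_deg M N x g L v : degA e M = degA e N -> alt_walk e M N x g L ->
  degA e M v = \sum_(t < L) (x t == v).
Proof.
move=> d w; apply: double_inj.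
have E k : degA e (seg false g 0 k) v + degA e (seg true g 0 k) v =
           \sum_(0 <= t < k) ((x t == v) + (x t.+1 == v)).
  elim: k => [|k IH]; first by rewrite !seg_nil degA0 big_geq // mnm0E.
  rewrite big_nat_recr //= -IH !seg_recr // !degAD_eval -(degA_edgeE v (aw_edge w k)).
  by case: (odd k); rewrite /= degA0 mnm0E; lia.
rewrite -addnn {2}d {1}(aw_M w) (aw_N w) E big_split /= -addnn.
rewrite -(big_mkord xpredT (fun t => nat_of_bool (x t == v))); congr (_ + _).
have : \sum_(0 <= t < L.+1) (x t == v) = \sum_(0 <= t < L) (x t == v) + (x L == v).
  exact: big_nat_recr.
by rewrite big_nat_recl //= (aw_xL w) addnC => /addIn.
Qed.

Lemma walk_degP M N x g L v : degA e M = degA e N -> alt_walk e M N x g L ->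
  0 < degA e M v -> exists2 t, t < L & x t = v.
Proof.
move=> d w; rewrite (walk_deg v d w) lt0n sum_nat_eq0 => /forallPn[/= t].
by rewrite eqb0 negbK => /eqP; exists t.
Qed.

Lemma walk_deg_gt0 M N x g L t : degA e M = degA e N -> alt_walk e M N x g L ->
  0 < degA e M (x t).
Proof.
move=> d w; have [L0 h] := (aw_pos w, aw_edge w t).
have w' := alt_walk_shift t w.
have := aw_gt0 w' L0; rewrite /= addn0; case: (odd t) => Mg.
  by rewrite d; exact: degA_gt0_edge h Mg.
exact: degA_gt0_edge h Mg.
Qed.

Lemma walk_deg2P M N x g L v : degA e M = degA e N -> alt_walk e M N x g L ->
  1 < degA e M v -> exists i j, [/\ i < j, j < L, x i = v & x j = v].
Proof.
move=> d w h.
have [i iL xi] := walk_degP d w (ltnW h).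
move: h; rewrite (walk_deg v d w) (bigD1 (Ordinal iL)) //= xi eqxx ltnS lt0n.
rewrite sum_nat_eq0 => /forallPn[/= j]; rewrite negb_imply eqb0 negbK => /andP[ji /eqP xj].
have {ji} ji : (j : nat) != i by [].
case: (ltnP i j) => ij; first by exists i, j.
by exists j, i; split=> //; lia.
Qed.

Lemma walk_deg_le2 M N x g L v : prim e M N -> alt_walk e M N x g L -> degA e M v <= 2.
Proof.
move=> pr w; have [d _ _] := pr; rewrite leqNgt; apply/negP => h.
have [i [j [ij jL xi xj]]] := walk_deg2P d w (ltnW h).
have iL := ltn_trans ij jL.
move: h; rewrite (walk_deg v d w) (bigD1 (Ordinal iL)) //= (bigD1 (Ordinal jL)) /=;
  last by rewrite -val_eqE /= gtn_eqF.
rewrite xi xj eqxx !ltnS lt0n sum_nat_eq0 => /forallPn[/= k].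
rewrite negb_imply eqb0 negbK -!val_eqE /= => /andP[/andP[ki kj] /eqP/val_inj xk].
have {}ki : (k : nat) != i by [].
have {}kj : (k : nat) != j by [].
have kL := ltn_ord k.
have [h1|h1] := ltnP k i; first by apply: (@three_visits _ _ _ _ _ k i j pr w); rewrite ?xi ?xj ?xk //; lia.
have [h2|h2] := ltnP k j; first by apply: (@three_visits _ _ _ _ _ i k j pr w); rewrite ?xi ?xj ?xk //; lia.
by apply: (@three_visits _ _ _ _ _ i j k pr w); rewrite ?xi ?xj ?xk //; lia.
Qed.

End WalkGeometry.

(** * Induced dumbbells *)

Section PathEdges.
Variable n : nat.
Implicit Types (s t c : seq 'I_n) (a x y z : 'I_n) (X Y : nat -> 'I_n).

Lemma path_edges_cat s z t :
  path_edges (s ++ z :: t) = path_edges (rcons s z) ++ path_edges (z :: t).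
Proof. by elim: s => [|x [|y s] IH] //=; rewrite -IH. Qed.

Lemma mem_path_edges_rev s x y :
  ((x, y) \in path_edges (rev s)) = ((y, x) \in path_edges s).
Proof.
elim: s => [|z [|z' s] IH] //.
rewrite rev_cons -cats1 rev_cons cat_rcons path_edges_cat -rev_cons mem_cat IH /= !inE orbC.
by congr (_ || _); rewrite !xpair_eqE andbC.
Qed.

Lemma path_edges_iotaP X (p d : nat) x y :
  reflect (exists j, [/\ p <= j, j < p + d, x = X j & y = X j.+1])
          ((x, y) \in path_edges (map X (iota p d.+1))).
Proof.
elim: d p => [|d IH] p; first by apply: (iffP idP) => //= -[j [h1 h2]]; lia.
rewrite -[iota p _]/(p :: p.+1 :: iota p.+2 d) [map _ _]/= [path_edges _]/= inE.
apply: (iffP orP) => [[/eqP[-> ->]|/IH[j [h1 h2 h3 h4]]]|[j [h1 h2 ex ey]]].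
- by exists p; split=> //; lia.
- by exists j; split=> //; lia.
have [jp|jp] := eqVneq j p; first by left; rewrite ex ey jp.
right.
by apply/IH; exists j; split=> //; lia.
Qed.

Lemma cycle_edges_cons a c : cycle_edges (a :: c) = path_edges (a :: rcons c a).
Proof.
rewrite /cycle_edges rot1_cons /path_edges [behead _]/=.
have -> : zip (a :: rcons c a) (rcons c a) = zip ((a :: c) ++ [:: a]) (rcons c a ++ [::]).
  by rewrite cats0 cats1.
by rewrite zip_cat ?cats0 //= size_rcons.
Qed.

(** With head [X k = Y k] prepended, this is the cycle that climbs along [X] to index [k + d],
    crosses to [Y] and descends along [Y]. *)
Definition loop_tail X Y k d : seq 'I_n :=
  map X (iota k.+1 d) ++ rev (map Y (iota k.+1 d)).

Definition same_pair x y a b := x = a /\ y = b \/ x = b /\ y = a.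

Lemma in_pairsP (es : seq ('I_n * 'I_n)) x y :
  in_pairs es x y <-> exists a b, (a, b) \in es /\ same_pair x y a b.
Proof.
split=> [/orP[] h | [a [b [h [[-> ->]|[-> ->]]]]]].
- by exists x, y; split=> //; left.
- by exists y, x; split=> //; right.
- by rewrite /in_pairs h.
- by rewrite /in_pairs h orbT.
Qed.

Lemma same_pairC x y a b : same_pair x y a b -> same_pair x y b a.
Proof. by case; [right|left]. Qed.

Lemma in_pairs_cat (es es' : seq ('I_n * 'I_n)) x y :
  in_pairs (es ++ es') x y = in_pairs es x y || in_pairs es' x y.
Proof. by rewrite /in_pairs !mem_cat orbACA. Qed.

Lemma loop_edgesP X Y k d x y : X k = Y k ->
  in_pairs (cycle_edges (X k :: loop_tail X Y k d)) x y <->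
  (exists j, [/\ k <= j, j < k + d & same_pair x y (X j) (X j.+1)]) \/
  (exists j, [/\ k <= j, j < k + d & same_pair x y (Y j) (Y j.+1)]) \/
  same_pair x y (X (k + d)) (Y (k + d)).
Proof.
move=> XY; rewrite cycle_edges_cons.
have -> : X k :: rcons (loop_tail X Y k d) (X k) =
    map X (iota k d) ++ X (k + d) :: rev (map Y (iota k d.+1)).
  rewrite /loop_tail rcons_cat {2}XY -rev_cons -[Y k :: _]/(map Y (iota k d.+1)) -cat_cons.
  by rewrite -[X k :: _]/(map X (iota k d.+1)) -addn1 iotaD map_cat -catA.
rewrite path_edges_cat -map_rcons.
have -> : rcons (iota k d) (k + d) = iota k d.+1 by rewrite -addn1 iotaD cats1.
have E : rev (map Y (iota k d.+1)) = Y (k + d) :: rev (map Y (iota k d)).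
  by rewrite -addn1 iotaD map_cat rev_cat.
have -> : path_edges (X (k + d) :: rev (map Y (iota k d.+1))) =
     (X (k + d), Y (k + d)) :: path_edges (rev (map Y (iota k d.+1))) by rewrite E.
rewrite in_pairsP; split.
  move=> [a [b [+ sp]]]; rewrite mem_cat inE => /orP[/path_edges_iotaP[j [h1 h2 h3 h4]]|/orP[/eqP[h1 h2]|]].
  - by left; exists j; rewrite -h3 -h4.
  - by right; right; rewrite -h1 -h2.
  - rewrite mem_path_edges_rev => /path_edges_iotaP[j [h1 h2 h3 h4]].
    by right; left; exists j; rewrite -h3 -h4; split=> //; exact: same_pairC.
case=> [[j [h1 h2 sp]]|[[j [h1 h2 sp]]|sp]].
- exists (X j), (X j.+1); split=> //; rewrite mem_cat; apply/orP; left.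
  by apply/path_edges_iotaP; exists j.
- exists (Y j.+1), (Y j); split; last exact: same_pairC.
  rewrite mem_cat inE mem_path_edges_rev; apply/orP; right; apply/orP; right.
  by apply/path_edges_iotaP; exists j.
- by exists (X (k + d)), (Y (k + d)); rewrite mem_cat inE eqxx orbT.
Qed.

(** With head [X k] prepended, this is the path that descends along [X] to [X 0 = X' 0] and climbs
    along [X'] to [X' k']. *)
Definition joint_tail X X' k k' : seq 'I_n :=
  rev (map X (iota 0 k)) ++ map X' (iota 1 k').

Lemma joint_edgesP X X' k k' x y : X 0 = X' 0 ->
  in_pairs (path_edges (X k :: joint_tail X X' k k')) x y <->
  (exists2 j, j < k & same_pair x y (X j) (X j.+1)) \/
  (exists2 j, j < k' & same_pair x y (X' j) (X' j.+1)).
Proof.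
move=> XX.
have -> : X k :: joint_tail X X' k k' = rev (map X (iota 1 k)) ++ X 0 :: map X' (iota 1 k').
  have E : rev (map X (iota 0 k.+1)) = X k :: rev (map X (iota 0 k)).
    by rewrite -addn1 iotaD map_cat rev_cat.
  by rewrite -cat_rcons -rev_cons -[X 0 :: map X _]/(map X (iota 0 k.+1)) E.
rewrite path_edges_cat -rev_cons -[X 0 :: map X _]/(map X (iota 0 k.+1)) XX.
rewrite -[X' 0 :: _]/(map X' (iota 0 k'.+1)) in_pairs_cat.
split.
  case/orP=> /in_pairsP[a [b []]]; last first.
    move=> /path_edges_iotaP[j [h1 h2 h3 h4]] sp; right; exists j => //.
    by rewrite -h3 -h4.
  rewrite mem_path_edges_rev => /path_edges_iotaP[j [h1 h2 h3 h4]] sp; left; exists j => //.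
  by rewrite -h3 -h4; exact: same_pairC.
case=> -[j h sp]; apply/orP; [left | right]; apply/in_pairsP.
  exists (X j.+1), (X j); split; last exact: same_pairC.
  by rewrite mem_path_edges_rev; apply/path_edges_iotaP; exists j.
by exists (X' j), (X' j.+1); split=> //; apply/path_edges_iotaP; exists j.
Qed.

End PathEdges.

Lemma max_below (Q : nat -> Prop) s : 0 < s -> Q 0 ->
  exists k, [/\ k < s, Q k & forall k', k' < s -> Q k' -> k' <= k].
Proof.
move=> + Q0; elim: s => // -[|s] IH _; first by exists 0; split.
have [Qs|nQ] := classic (Q s.+1); first by exists s.+1; split.
have [//|k [ks Qk mx]] := IH; exists k; split=> //; first exact: leqW.
move=> k'; rewrite ltnS leq_eqVlt => /orP[/eqP -> //|]; exact: mx.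
Qed.

(** * Breadth-first levels, geodesics and lollipops *)

Section Levels.
Variables (n : nat) (h : rel 'I_n).
Hypothesis h_sym : forall x y, h x y = h y x.
Hypothesis h_irr : irreflexive h.
Implicit Types (u v x y z : 'I_n) (X Y : nat -> 'I_n) (V B : pred 'I_n).

Fixpoint reach u (k : nat) y : bool :=
  if k is k'.+1 then [exists z, h z y && reach u k' z] else y == u.

(** The properties of the breadth-first distance from [u] on which the construction rests. *)
Record level_fun V u (D : 'I_n -> nat) : Prop := LevelFun {
  lv_root : D u = 0;
  lv_root_uniq : forall v, V v -> D v = 0 -> v = u;
  lv_pred : forall v k, V v -> D v = k.+1 -> exists2 z, h z v & D z = k;
  lv_step : forall y z, h y z -> D z <= (D y).+1 }.

Lemma level_fun_exists V u b : (forall x y, h x y -> V x) ->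
  (forall v, V v -> exists2 k, k < b & reach u k v) ->
  exists D, level_fun V u D.
Proof.
(* [D y] is the length of a shortest walk from [u] to [y]; unreachable vertices receive the default
   value [b]. *)
move=> hV hr; pose D y := find (fun k => reach u k y) (iota 0 b).
have hr' v : V v -> has (fun k => reach u k v) (iota 0 b).
  by move=> /hr[k kb rk]; apply/hasP; exists k; rewrite ?mem_iota.
have Db v : V v -> D v < b by move/hr'; rewrite has_find size_iota.
have Dr v : V v -> reach u (D v) v.
  move=> Vv; have := nth_find 0 (hr' v Vv); rewrite nth_iota ?add0n //.
  exact: Db.
have Dle k v : V v -> reach u k v -> D v <= k.
  move=> Vv rk; rewrite leqNgt; apply/negP => kD.
  have := before_find 0 kD; rewrite nth_iota ?add0n ?rk //.
  exact: ltn_trans kD (Db v Vv).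
have st y z : h y z -> D z <= (D y).+1.
  move=> hyz; apply: Dle; first by apply: (hV z y); rewrite h_sym.
  by apply/existsP; exists y; apply/andP; split; [|apply: Dr; exact: hV hyz].
exists D; split=> //.
- by rewrite /D; case: (b) => //= b'; rewrite eqxx.
- by move=> v /Dr + D0; rewrite D0 => /eqP.
- move=> v k Vv Dv; have := Dr v Vv; rewrite Dv => /existsP[z /andP[hzv rz]].
  exists z => //; apply/eqP; rewrite eqn_leq (Dle k z) ?(hV _ _ hzv) //=.
  by have := st _ _ hzv; rewrite Dv.
Qed.

Variables (V : pred 'I_n) (u : 'I_n) (D : 'I_n -> nat).
Hypothesis hV : forall x y, h x y -> V x.
Hypothesis lv : level_fun V u D.

Definition geodesic X r := [/\ X 0 = u, (forall j, j < r -> h (X j) (X j.+1)) &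
  (forall j, j <= r -> D (X j) = j)].

Lemma geodesic_to v : V v -> exists2 X, geodesic X (D v) & X (D v) = v.
Proof.
move En : (D v) => k; elim: k v En => [|k IH] v Dv Vv.
  have vu := lv_root_uniq lv Vv Dv.
  exists (fun _ => u) => //; split=> //= j; rewrite leqn0 => /eqP ->.
  exact: lv_root lv.
have [z hzv Dz] := lv_pred lv Vv Dv.
have [X [X0 Xh XD] Xk] := IH z Dz (hV hzv).
exists (fun j => if j <= k then X j else v); last by rewrite ltnn.
split=> // j; rewrite ?ltnS => jk.
  by rewrite jk; case: ltnP => [jk'|kj]; [exact: Xh | rewrite (_ : j = k) ?Xk //; lia].
by case: leqP => [/XD //|kj]; lia.
Qed.

Lemma level_adj x y : h x y -> D x <= (D y).+1 /\ D y <= (D x).+1.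
Proof. by move=> hxy; split; apply: (lv_step lv); rewrite // h_sym. Qed.

Lemma geodesic_splice X Y i r : geodesic X r -> geodesic Y r -> i < r ->
  X i = Y i \/ h (X i) (Y i.+1) -> geodesic (fun j => if j <= i then X j else Y j) r.
Proof.
move=> [X0 Xh XD] [Y0 Yh YD] ir hi; split=> //= j jr; last first.
  by case: leqP => _; [exact: XD | exact: YD].
case: (ltngtP j i) => ji; [exact: Xh | exact: Yh | rewrite ji].
by case: hi => [->|//]; exact: Yh.
Qed.

(** Only [v] may have neighbours outside [B], and the root is not in [B] unless it is [v]: the set
    [B] hangs from the rest of the graph at [v]. *)
Definition attached B v := [/\ B v, (forall x, B x -> V x),
  (forall x y, B x -> x != v -> h x y -> B y) & (B u -> u = v)].

Lemma attached_level B v x : attached B v -> B x -> D v <= D x.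
Proof.
case=> Bv BV Bout Bu; move En : (D x) => k; elim: k x En => [|k IH] x Dx Bx.
  by rewrite -(Bu _) ?(lv_root lv) // -(lv_root_uniq lv (BV x Bx) Dx).
have [xv|xv] := eqVneq x v; first by rewrite -xv Dx.
have [z hzx Dz] := lv_pred lv (BV x Bx) Dx.
by apply: leqW; apply: (IH z) => //; apply: (Bout x); rewrite // h_sym.
Qed.

Lemma attached_geodesic B v X r : attached B v -> geodesic X r -> B (X r) ->
  forall j, D v <= j -> j <= r -> B (X j).
Proof.
move=> att [X0 Xh XD] Br j vj jr.
have [s sr js] : exists2 s, s <= r & j = r - s by exists (r - j); lia.
move: vj; rewrite js {js jr}; elim: s sr => [|s IH] sr vs; first by rewrite subn0.
have Bs : B (X (r - s)) by apply: IH; lia.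
have [_ _ Bout _] := att; apply: (Bout (X (r - s))) => //.
  by apply/eqP => eq; have := XD (r - s); rewrite eq; lia.
rewrite h_sym; have -> : r - s = (r - s.+1).+1 by lia.
by apply: Xh; lia.
Qed.

(** Followed backwards from its end, the geodesic can leave [B] only at [v], and [v] is the only
    vertex of [B] on the lowest level met by [B]. *)
Lemma geodesic_through B v X r : attached B v -> geodesic X r -> B (X r) ->
  D v <= r /\ X (D v) = v.
Proof.
move=> att gX Br; have [X0 Xh XD] := gX; have [Bv BV Bout Bu] := att.
have vr : D v <= r by have := attached_level att Br; rewrite XD.
have Bk := attached_geodesic att gX Br (leqnn _) vr.
split=> //; apply/eqP; apply: contraT => neq.
case Ek : (D v) => [|k].
  by move: neq; rewrite Ek X0 (lv_root_uniq lv (BV _ Bv) Ek) eqxx.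
have hk : h (X (D v)) (X k) by rewrite h_sym Ek; apply: Xh; lia.
have := attached_level att (Bout _ _ Bk neq hk).
by rewrite XD; lia.
Qed.

(* an induced odd cycle (the X i, Y i with k <= i <= r) hanging from the root by
   a shortest path *)
Record lollipop B v k r X Y : Prop := Lollipop {
  lo_X : geodesic X r;
  lo_Y : geodesic Y r;
  lo_kr : k < r;
  lo_vk : D v <= k;
  lo_stem : forall j, j <= k -> X j = Y j;
  lo_BX : forall j, D v <= j -> j <= r -> B (X j);
  lo_BY : forall j, D v <= j -> j <= r -> B (Y j);
  lo_top : h (X r) (Y r);
  lo_neq : forall i j, k < i -> i <= r -> j <= r -> X i <> Y j;
  lo_ind : forall i j, k < i -> k < j -> i <= r -> j <= r -> h (X i) (Y j) -> i = r /\ j = r }.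

(* Take an edge inside a level, of minimal level r, and two geodesics to its ends
   that separate as late as possible: a further adjacency between them would
   give either a lower such edge or a later separation. *)
Lemma lollipop_exists B v x0 y0 : attached B v -> B x0 -> B y0 -> h x0 y0 -> D x0 = D y0 ->
  exists k r X Y, lollipop B v k r X Y.
Proof.
move=> att Bx0 By0 hxy0 Dxy0; have [Bv BV Bout Bu] := att.
pose P r := [exists x, exists y, [&& B x, B y, h x y, D x == r & D y == r]].
have exP : exists r, P r.
  exists (D x0); apply/existsP; exists x0; apply/existsP; exists y0.
  by rewrite Bx0 By0 hxy0 -Dxy0 eqxx.
have [r /existsP[x /existsP[y /and5P[Bx By hxy /eqP Dx /eqP Dy]]] minr] := ex_minnP exP.
pose Q k := exists X Y, [/\ geodesic X r, geodesic Y r, X r = x, Y r = y & X k = Y k].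
have [X0 gX0 X0r] := geodesic_to (BV x Bx); have [Y0 gY0 Y0r] := geodesic_to (BV y By).
rewrite Dx in gX0 X0r; rewrite Dy in gY0 Y0r.
have Qv : Q (D v).
  exists X0, Y0; split=> //.
  have [_ ->] := geodesic_through att gX0 (ltac:(by rewrite X0r) : B (X0 r)).
  by have [_ ->] := geodesic_through att gY0 (ltac:(by rewrite Y0r) : B (Y0 r)).
have vr : D v < r.
  have [+ Xv] := geodesic_through att gX0 (ltac:(by rewrite X0r) : B (X0 r)).
  have [_ Yv] := geodesic_through att gY0 (ltac:(by rewrite Y0r) : B (Y0 r)).
  rewrite leq_eqVlt => /orP[/eqP eq|//]; move: hxy.
  by rewrite -X0r -Y0r -eq Xv Yv h_irr.
have Q0 : Q 0 by exists X0, Y0; split=> //; case: gX0 gY0 => -> _ _ [-> _ _].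
have [k [kr [X [Y [gX gY Xr Yr XYk]]] maxk]] := max_below (leq_ltn_trans (leq0n _) vr) Q0.
(* [Y] is rerouted along [X] up to the last level where they meet, so that both geodesics have
   literally the same stem. *)
pose Y' := fun j => if j <= k then X j else Y j.
have gY' : geodesic Y' r by apply: geodesic_splice => //; left.
have Y'r : Y' r = y by rewrite /Y' leqNgt kr.
have vk : D v <= k by exact: maxk.
have [[_ _ XD] [_ _ YD]] := (gX, gY).
have BX := attached_geodesic att gX (ltac:(by rewrite Xr) : B (X r)).
have BY := attached_geodesic att gY (ltac:(by rewrite Yr) : B (Y r)).
exists k, r, X, Y'; split=> //.
- by move=> j jk; rewrite /Y' jk.
- by move=> j vj jr; rewrite /Y'; case: ifP => _; [exact: BX | exact: BY].
- by rewrite Xr Y'r.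
- move=> i j ki ir jr eq; have [_ _ Y'D] := gY'.
  have ij : i = j by rewrite -(XD i) // eq Y'D.
  subst j; move: ir; rewrite leq_eqVlt => /orP[/eqP ir|ir].
    by move: hxy; rewrite -Xr -Y'r -ir eq h_irr.
  have /maxk : Q i by exists X, Y'.
  by move=> /(_ ir); lia.
- move=> i j ki kj ir jr; rewrite /Y' leqNgt kj /= => hij.
  have [] := level_adj hij; rewrite XD // YD // => l1 l2.
  have [ij|ij] := eqVneq i j.
    subst j; split; apply/eqP; rewrite eqn_leq ir minr //;
    by apply/existsP; exists (X i); apply/existsP; exists (Y i); rewrite BX ?BY ?hij ?XD ?YD ?eqxx //; lia.
  have [ji|ji] : j = i.+1 \/ i = j.+1 by lia.
    have Qi : Q i.
      exists X, (fun t => if t <= i then X t else Y t); split=> //; last by rewrite leqnn.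
        by apply: geodesic_splice; rewrite // -?ji; [lia|right].
      by rewrite ifN //; lia.
    by have := maxk i (ltac:(lia)) Qi; lia.
  have Qj : Q j.
    exists (fun t => if t <= j then Y t else X t), Y; split=> //; last by rewrite leqnn.
      by apply: geodesic_splice; rewrite // -?ji; [lia|right; rewrite h_sym].
    by rewrite ifN //; lia.
  by have := maxk j (ltac:(lia)) Qj; lia.
Qed.

End Levels.

(** * The odd cycle of a lollipop *)

Section LollipopCycle.
Variables (n : nat) (h : rel 'I_n).
Hypothesis h_sym : forall x y, h x y = h y x.
Hypothesis h_irr : irreflexive h.
Variables (V : pred 'I_n) (u : 'I_n) (D : 'I_n -> nat).
Hypothesis hV : forall x y, h x y -> V x.
Hypothesis lv : level_fun h V u D.
Variables (B : pred 'I_n) (v : 'I_n) (k r : nat) (X Y : nat -> 'I_n).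
Hypothesis lo : lollipop h u D B v k r X Y.

Definition loop := X k :: loop_tail X Y k (r - k).

Lemma loopE : loop = map X (iota k (r - k).+1) ++ rev (map Y (iota k.+1 (r - k))).
Proof. by []. Qed.

Lemma mem_loop x : x \in loop ->
  exists2 j, k <= j <= r & x = X j \/ k < j /\ x = Y j.
Proof.
have kr := lo_kr lo.
rewrite loopE mem_cat mem_rev => /orP[] /mapP[j + ->]; rewrite mem_iota => hj.
  by exists j; [lia | left].
by exists j; [lia | right; split=> //; lia].
Qed.

Lemma lo_DX j : j <= r -> D (X j) = j.
Proof. by case: (lo_X lo) => _ _; apply. Qed.

Lemma lo_DY j : j <= r -> D (Y j) = j.
Proof. by case: (lo_Y lo) => _ _; apply. Qed.

Lemma mem_loop_level x : x \in loop -> k <= D x.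
Proof.
by move=> /mem_loop[j jr [->|[_ ->]]]; rewrite ?lo_DX ?lo_DY; lia.
Qed.

Lemma mem_loop_B x : x \in loop -> B x.
Proof.
have vk := lo_vk lo.
by move=> /mem_loop[j jr [->|[_ ->]]]; [apply: (lo_BX lo) | apply: (lo_BY lo)]; lia.
Qed.

Lemma uniq_map_level Z s : (forall j, j \in s -> D (Z j) = j) -> uniq s -> uniq (map Z s).
Proof.
move=> ZD us; rewrite map_inj_in_uniq // => i j si sj eq.
by rewrite -(ZD i si) -(ZD j sj) eq.
Qed.

Lemma loop_uniq : uniq loop.
Proof.
have kr := lo_kr lo.
rewrite loopE cat_uniq rev_uniq !uniq_map_level ?iota_uniq ?andbT //.
- apply/hasPn => y; rewrite mem_rev => /mapP[j + ->]; rewrite mem_iota => hj.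
  suff : Y j \notin map X (iota k (r - k).+1) by [].
  apply/negP => /mapP[i]; rewrite mem_iota => hi eq.
  have ij : i = j by rewrite -(@lo_DX i) -?eq ?lo_DY //; lia.
  by apply: (lo_neq lo (i := i) (j := j)) => //; lia.
- by move=> j; rewrite mem_iota => hj; apply: lo_DY; lia.
- by move=> j; rewrite mem_iota => hj; apply: lo_DX; lia.
Qed.

Lemma size_loop : 2 <= size (loop_tail X Y k (r - k)) /\ ~~ odd (size (loop_tail X Y k (r - k))).
Proof.
have kr := lo_kr lo.
by rewrite size_cat size_rev !size_map size_iota; lia.
Qed.

(** Adjacent vertices are at most one level apart and a geodesic has one vertex on each level; edges
    between the two branches are limited by [lo_ind]. *)
Lemma lollipop_adj i j : i <= r -> j <= r ->
  [/\ h (X i) (X j) -> j = i.+1 \/ i = j.+1,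
      h (Y i) (Y j) -> j = i.+1 \/ i = j.+1 &
      k < j -> h (X i) (Y j) -> i = r /\ j = r \/ i = k /\ j = k.+1].
Proof.
move=> ir jr; have lev := level_adj h_sym lv.
split=> [hij|hij|kj hij]; have [] := lev _ _ hij; rewrite ?lo_DX ?lo_DY // => l1 l2.
- by have [ij|] := eqVneq i j; [move: hij; rewrite ij h_irr | lia].
- by have [ij|] := eqVneq i j; [move: hij; rewrite ij h_irr | lia].
have [ik|ki] := leqP i k; first by right; lia.
by left; exact: (lo_ind lo ki kj ir jr hij).
Qed.

End LollipopCycle.

(** * Two lollipops with a common root form an induced dumbbell *)

Section Dumbbell.
Variables (n m : nat) (e : 'I_m -> 'I_n * 'I_n).
Hypothesis noloop : forall i, (e i).1 != (e i).2.
Variables (V : pred 'I_n) (u v : 'I_n) (D : 'I_n -> nat).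

(** Levels are computed in the subgraph induced on [V]; a dumbbell induced there is induced in the
    whole graph. *)
Definition adjV : rel 'I_n := fun x y => [&& adj e x y, V x & V y].

Lemma adjC x y : adj e x y = adj e y x.
Proof. by rewrite /adj; apply: eq_existsb => i; rewrite edge_isC. Qed.

Lemma adjV_sym x y : adjV x y = adjV y x.
Proof. by rewrite /adjV adjC; case: (adj e y x); case: (V x); case: (V y). Qed.

Lemma adjV_irr : irreflexive adjV.
Proof.
move=> x; apply/negP => /and3P[/existsP[i /(edge_neq noloop)]].
by rewrite eqxx.
Qed.

Lemma adjV_V x y : adjV x y -> V x.
Proof. by case/and3P. Qed.

Hypothesis lv : level_fun adjV V u D.
Variables A B : pred 'I_n.
Hypothesis attA : attached adjV V u A u.
Hypothesis attB : attached adjV V u B v.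
Hypothesis disAB : forall x, A x -> ~~ B x.
Hypothesis vu : v != u.
Variables (k r : nat) (X Y : nat -> 'I_n) (k' r' : nat) (X' Y' : nat -> 'I_n).
Hypothesis loA : lollipop adjV u D A u k r X Y.
Hypothesis loB : lollipop adjV u D B v k' r' X' Y'.

Let X0 : X 0 = X' 0.
Proof. by case: (lo_X loA) (lo_X loB) => -> _ _ [-> _ _]. Qed.

(** Since [v] is not the root, its level is positive; this gives the joining path at least one
    edge. *)
Let k'0 : 0 < k'.
Proof.
apply: leq_trans (lo_vk loB); rewrite lt0n; apply: contra vu => /eqP Dv.
case: attB => Bv BV _ _; apply/eqP; exact: (lv_root_uniq lv (BV v Bv) Dv).
Qed.

Let AX j : j <= r -> A (X j).
Proof. by apply: (lo_BX loA); rewrite (lv_root lv). Qed.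

Let AY j : j <= r -> A (Y j).
Proof. by apply: (lo_BY loA); rewrite (lv_root lv). Qed.

(** A geodesic that is in [A] after the root can never leave [A] again, since only the root has
    neighbours outside; but it ends in [B], which is disjoint from [A]. *)
Let out_geodesic Z j : geodesic adjV u D Z r' -> B (Z r') -> 0 < j -> j <= r' -> ~~ A (Z j).
Proof.
move=> [Z0 Zh ZD] Br j0 jr; apply/negP => Aj.
suff Ar i : A (Z (j + i)) \/ r' < j + i.
  have [Ar'|] := Ar (r' - j); last by lia.
  by move: Br; rewrite -[r'](subnKC jr) => Br; have := disAB Ar'; rewrite Br.
elim: i => [|i [IH|IH]]; [by left; rewrite addn0| |by right; lia].
have [ij|ij] := leqP (j + i.+1) r'; last by right.
left; case: attA => _ _ Aout _; apply: (Aout (Z (j + i))) => //.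
  by apply/eqP => eq; have := ZD (j + i); rewrite eq (lv_root lv); lia.
by rewrite addnS; apply: Zh; lia.
Qed.

Let outX' j : 0 < j -> j <= r' -> ~~ A (X' j).
Proof.
apply: out_geodesic (lo_X loB) _; apply: (lo_BX loB) => //.
exact: leq_trans (lo_vk loB) (ltnW (lo_kr loB)).
Qed.

Let outY' j : 0 < j -> j <= r' -> ~~ A (Y' j).
Proof.
apply: out_geodesic (lo_Y loB) _; apply: (lo_BY loB) => //.
exact: leq_trans (lo_vk loB) (ltnW (lo_kr loB)).
Qed.

Let cross x y : A x -> x != u -> ~~ A y -> ~~ adjV x y.
Proof.
by move=> Ax xu; apply: contra => hxy; case: attA => _ _ Aout _; apply: Aout hxy.
Qed.

(** The joining path descends the stem of the first lollipop to the root and climbs the stem of the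
    second. *)
Let a := X k.
Let c1 := loop_tail X Y k (r - k).
Let b := X' k'.
Let c2 := loop_tail X' Y' k' (r' - k').
Let q := joint_tail X X' k k'.

Let kr := lo_kr loA.
Let kr' := lo_kr loB.

Inductive dumbbell_vertex : 'I_n -> Prop :=
| DvX i : i <= r -> dumbbell_vertex (X i)
| DvY i : k < i -> i <= r -> dumbbell_vertex (Y i)
| DvX' i : 0 < i -> i <= r' -> dumbbell_vertex (X' i)
| DvY' i : k' < i -> i <= r' -> dumbbell_vertex (Y' i).

Let vertexP x : x \in (a :: c1) ++ (b :: c2) ++ (a :: q) -> dumbbell_vertex x.
Proof.
rewrite !mem_cat => /or3P[/mem_loop|/mem_loop|].
- move=> /(_ _ _ _ _ _ loA)[j jr [->|[kj ->]]]; [apply: DvX | apply: DvY]; lia.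
- move=> /(_ _ _ _ _ _ loB)[j jr [->|[kj ->]]]; [apply: DvX' | apply: DvY']; lia.
rewrite inE mem_cat mem_rev => /or3P[/eqP ->|/mapP[j + ->]|/mapP[j + ->]];
  rewrite ?mem_iota => *; by [apply: DvX; lia | apply: DvX'; lia].
Qed.

Let E x y := in_pairs (cycle_edges (a :: c1) ++ cycle_edges (b :: c2) ++ path_edges (a :: q)) x y.

Let EC x y : E x y = E y x.
Proof. by rewrite /E /in_pairs orbC. Qed.

Let Edef x y : E x y = [|| in_pairs (cycle_edges (a :: c1)) x y,
  in_pairs (cycle_edges (b :: c2)) x y | in_pairs (path_edges (a :: q)) x y].
Proof. by rewrite /E !in_pairs_cat. Qed.

Let XY : X k = Y k := lo_stem loA (leqnn k).
Let XY' : X' k' = Y' k' := lo_stem loB (leqnn k').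

Let EX j : j < r -> E (X j) (X j.+1).
Proof.
move=> jr; rewrite Edef; case: (leqP k j) => kj.
  by apply/or3P/Or31/loop_edgesP => //; left; exists j; split; [lia|lia|by left].
by apply/or3P/Or33/joint_edgesP => //; left; exists j => //; left.
Qed.

Let EX' j : j < r' -> E (X' j) (X' j.+1).
Proof.
move=> jr; rewrite Edef; case: (leqP k' j) => kj.
  by apply/or3P/Or32/loop_edgesP => //; left; exists j; split; [lia|lia|by left].
by apply/or3P/Or33/joint_edgesP => //; right; exists j => //; left.
Qed.

Let EY j : k <= j -> j < r -> E (Y j) (Y j.+1).
Proof.
move=> kj jr; rewrite Edef.
by apply/or3P/Or31/loop_edgesP => //; right; left; exists j; split; [lia|lia|by left].
Qed.

Let EY' j : k' <= j -> j < r' -> E (Y' j) (Y' j.+1).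
Proof.
move=> kj jr; rewrite Edef.
by apply/or3P/Or32/loop_edgesP => //; right; left; exists j; split; [lia|lia|by left].
Qed.

Let Etop : E (X r) (Y r).
Proof.
rewrite Edef; apply/or3P/Or31/loop_edgesP => //; right; right.
by rewrite subnKC; [left | lia].
Qed.

Let Etop' : E (X' r') (Y' r').
Proof.
rewrite Edef; apply/or3P/Or32/loop_edgesP => //; right; right.
by rewrite subnKC; [left | lia].
Qed.

Let E_adj x y : E x y -> adjV x y.
Proof.
have [_ hX _] := lo_X loA; have [_ hY _] := lo_Y loA.
have [_ hX' _] := lo_X loB; have [_ hY' _] := lo_Y loB.
have sp x1 x2 p1 p2 : adjV p1 p2 -> same_pair x1 x2 p1 p2 -> adjV x1 x2.
  by move=> hp [[-> ->]|[-> ->]]; rewrite // adjV_sym.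
rewrite Edef => /or3P[/loop_edgesP|/loop_edgesP|/joint_edgesP].
- case=> // [[j [h1 h2]]|[[j [h1 h2]]|]]; apply: sp; [apply: hX; lia | apply: hY; lia |].
  by rewrite subnKC; [exact: lo_top loA | lia].
- case=> // [[j [h1 h2]]|[[j [h1 h2]]|]]; apply: sp; [apply: hX'; lia | apply: hY'; lia |].
  by rewrite subnKC; [exact: lo_top loB | lia].
- case=> // -[j jk]; apply: sp; [apply: hX; lia | apply: hX'; lia].
Qed.

(** Inside one lollipop, levels decide which vertices can be adjacent. Between the two, the root
    [X 0 = X' 0] is the only vertex of [A] with neighbours outside [A]. *)
Let adj_E x y : dumbbell_vertex x -> dumbbell_vertex y -> adjV x y -> E x y.
Proof.
have LA i j := lollipop_adj adjV_sym adjV_irr lv loA (i := i) (j := j).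
have LB i j := lollipop_adj adjV_sym adjV_irr lv loB (i := i) (j := j).
have XYc i j : i <= r -> k < j -> j <= r -> adjV (X i) (Y j) -> E (X i) (Y j).
  move=> ir kj jr hij; have [_ _ /(_ kj hij)[[-> ->]|[-> ->]]] := LA i j ir jr => //.
  by rewrite XY; apply: EY; lia.
have XYc' i j : i <= r' -> k' < j -> j <= r' -> adjV (X' i) (Y' j) -> E (X' i) (Y' j).
  move=> ir kj jr hij; have [_ _ /(_ kj hij)[[-> ->]|[-> ->]]] := LB i j ir jr => //.
  by rewrite XY'; apply: EY'; lia.
have Xu i : 0 < i -> i <= r -> X i != u.
  by move=> i0 ir; apply/eqP => eq; have := lo_DX loA ir; rewrite eq (lv_root lv); lia.
have Yu i : 0 < i -> i <= r -> Y i != u.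
  by move=> i0 ir; apply/eqP => eq; have := lo_DY loA ir; rewrite eq (lv_root lv); lia.
have XXc i j : i <= r -> 0 < j -> j <= r' -> adjV (X i) (X' j) -> E (X i) (X' j).
  case: i => [|i] ir j0 jr hij.
    move: hij; rewrite X0 => hij; have [/(_ hij) + _ _] := LB 0 j (leq0n _) jr.
    by case=> // ->; apply: EX'; lia.
  by move: hij; rewrite (negPf (cross (AX ir) (Xu _ _ ir) (outX' j0 jr))).
have XYc2 i j : i <= r -> k' < j -> j <= r' -> adjV (X i) (Y' j) -> E (X i) (Y' j).
  case: i => [|i] ir j0 jr hij.
    by move: hij; rewrite X0 => hij; apply: XYc'.
  by move: hij; rewrite (negPf (cross (AX ir) (Xu _ _ ir) (outY' (leq_ltn_trans (leq0n _) j0) jr))).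
have YXc i j : k < i -> i <= r -> 0 < j -> j <= r' -> ~~ adjV (Y i) (X' j).
  by move=> ki ir j0 jr; apply: cross (AY ir) (Yu _ (leq_ltn_trans (leq0n _) ki) ir) (outX' j0 jr).
have YYc i j : k < i -> i <= r -> 0 < j -> j <= r' -> ~~ adjV (Y i) (Y' j).
  by move=> ki ir j0 jr; apply: cross (AY ir) (Yu _ (leq_ltn_trans (leq0n _) ki) ir) (outY' j0 jr).
case=> [i ir|i ki ir|i ki ir|i ki ir] [j jr|j kj jr|j kj jr|j kj jr] hij.
- have [/(_ hij) + _ _] := LA i j ir jr.
  by case=> [ji|ij]; subst; [apply: EX | rewrite EC; apply: EX].
- exact: XYc.
- exact: XXc.
- exact: XYc2.
- by rewrite EC; apply: XYc; rewrite // adjV_sym.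
- have [_ /(_ hij) + _] := LA i j ir jr.
  by case=> [ji|ij]; subst; [apply: EY | rewrite EC; apply: EY]; lia.
- by move: hij; rewrite (negPf (YXc _ _ _ _ _ _)).
- by move: hij; rewrite (negPf (YYc _ _ _ _ _ _)) //; lia.
- by rewrite EC; apply: XXc; rewrite // adjV_sym.
- by move: hij; rewrite adjV_sym (negPf (YXc _ _ _ _ _ _)).
- have [/(_ hij) + _ _] := LB i j ir jr.
  by case=> [ji|ij]; subst; [apply: EX' | rewrite EC; apply: EX'].
- exact: XYc'.
- by rewrite EC; apply: XYc2; rewrite // adjV_sym.
- by move: hij; rewrite adjV_sym (negPf (YYc _ _ _ _ _ _)) //; lia.
- by rewrite EC; apply: XYc'; rewrite // adjV_sym.
- have [_ /(_ hij) + _] := LB i j ir jr.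
  by case=> [ji|ij]; subst; [apply: EY' | rewrite EC; apply: EY']; lia.
Qed.

Let vertex_V x : dumbbell_vertex x -> V x.
Proof.
have [_ hX _] := lo_X loA; have [_ hY _] := lo_Y loA.
have [_ hX' _] := lo_X loB; have [_ hY' _] := lo_Y loB.
have aux Z s i : (forall j, j < s -> adjV (Z j) (Z j.+1)) -> 0 < s -> i <= s -> V (Z i).
  move=> hZ s0; rewrite leq_eqVlt => /orP[/eqP ->|/hZ /adjV_V //].
  by case: s hZ s0 => // s hZ _; have := hZ s (leqnn _); rewrite adjV_sym; exact: adjV_V.
case=> [i ir|i _ ir|i _ ir|i _ ir]; [apply: aux hX _ ir|apply: aux hY _ ir|apply: aux hX' _ ir|apply: aux hY' _ ir]; lia.
Qed.

Lemma dumbbell : two_odd_cycles_joined e a c1 b c2 q.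
Proof.
have rK : k' = k'.-1.+1 by lia.
have loopA x : x \in a :: c1 -> A x := mem_loop_B loA (x := x).
have loopB x : x \in b :: c2 -> ~~ A x.
  by move=> /(mem_loop_B loB) Bx; apply/negP => /disAB; rewrite Bx.
have qE : q = rcons (rev (map X (iota 0 k)) ++ map X' (iota 1 k'.-1)) b.
  have it : iota 1 k' = rcons (iota 1 k'.-1) k'.
    have it d : iota 1 d.+1 = rcons (iota 1 d) d.+1 by have := iotaD 1 d 1; rewrite addn1 add1n cats1.
    by rewrite rK; exact: it.
  by rewrite /q /joint_tail it map_rcons -rcons_cat.
split; first exact: loop_uniq loA.
split; first exact: loop_uniq loB.
split.
  have -> : a :: q = rev (map X (iota 0 k.+1)) ++ map X' (iota 1 k').
    by rewrite -addn1 iotaD map_cat rev_cat.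
  rewrite cat_uniq rev_uniq !(@uniq_map_level _ D) ?iota_uniq ?andbT //.
  - apply/hasPn => y /mapP[j + ->]; rewrite mem_iota => hj.
    suff : X' j \notin rev (map X (iota 0 k.+1)) by [].
    apply/negP; rewrite mem_rev => /mapP[i]; rewrite mem_iota => hi eq.
    have := @outX' j (ltac:(lia)) (ltac:(lia)); rewrite eq AX //; lia.
  - by move=> j; rewrite mem_iota => hj; apply: (lo_DX loB); lia.
  - by move=> j; rewrite mem_iota => hj; apply: (lo_DX loA); lia.
split; first exact: size_loop loA.
split; first exact: size_loop loB.
split.
  by rewrite qE last_rcons size_rcons; split.
split.
  rewrite disjoint_has; apply/hasPn => x /loopA Ax; apply/negP => /loopB.
  by rewrite Ax.
split.
  move=> x; rewrite {2}qE {1}qE size_rcons -cats1 take_size_cat // mem_cat mem_rev.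
  case/orP=> /mapP[j + ->]; rewrite mem_iota => hj.
    apply/andP; split.
      by apply/negP => /(mem_loop_level loA); rewrite (lo_DX loA); lia.
    by apply/negP => /loopB; rewrite AX //; lia.
  apply/andP; split.
    by apply/negP => /loopA; rewrite (negPf (outX' _ _)) //; lia.
  by apply/negP => /(mem_loop_level loB); rewrite (lo_DX loB); lia.
move=> x y /vertexP vx /vertexP vy; rewrite -/(E x y).
have -> : adj e x y = adjV x y by rewrite /adjV !vertex_V // !andbT.
apply/idP/idP; [exact: adj_E | exact: E_adj].
Qed.

End Dumbbell.

(** * At most one vertex is visited twice *)

Section DoubleVertices.
Variables (n m : nat) (e : 'I_m -> 'I_n * 'I_n).
Hypothesis noloop : forall i, (e i).1 != (e i).2.
Implicit Types (M N : 'X_{1..m}) (x : nat -> 'I_n) (g : nat -> 'I_m).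

Lemma nconn_sym M N : ~ conn e [::] M N -> ~ conn e [::] N M.
Proof. by move=> nc /conn_sym. Qed.

Lemma odd_chord_at M N x g L i j f : degA e M = degA e N -> ~ conn e [::] M N ->
  alt_walk e M N x g L -> i < j < i + L -> odd (j - i) -> edge_is e f (x i) (x j) ->
  j = i.+1 \/ j = i + L.-1.
Proof.
move=> d nc w ij oij hf; have w' := alt_walk_shift i w.
have hf' : edge_is e f (x (i + 0)) (x (i + (j - i))) by rewrite addn0 subnKC //; lia.
have h : 0 < j - i < L by lia.
have [||h'|h'] := @odd_chord _ _ _ _ _ _ _ _ _ _ _ _ w' h oij hf'; try lia.
  by case: (odd i).
by case: (odd i) => //; exact: nconn_sym.
Qed.

(** A chord between the two loops at [x 0 = x t] that preserves parity is excluded by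
    [no_chord_across], and one that changes parity must join consecutive vertices of the walk. Hence
    the double vertex is a cut vertex. *)
Lemma arc_attached M N x g L t i j : degA e M = degA e N -> ~ conn e [::] M N ->
  alt_walk e M N x g L -> 0 < i < t -> t < j < L -> x 0 = x t -> ~~ adj e (x i) (x j).
Proof.
move=> d nc w it tj xt; apply/negP => /existsP[f hf].
have [oij|oij] := eqVneq (odd i) (odd j); first exact: no_chord_across w it tj xt oij hf.
have ij : i < j < i + L by lia.
have o : odd (j - i) by lia.
by have [] := odd_chord_at d nc w ij o hf; lia.
Qed.

(** If every step changed the level by exactly one, a closed walk would have even length. *)
Lemma level_edge x (D : 'I_n -> nat) a b : a < b -> odd (b - a) -> x a = x b ->
  (forall t, D (x t) <= (D (x t.+1)).+1 /\ D (x t.+1) <= (D (x t)).+1) ->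
  exists2 t, a <= t < b & D (x t) = D (x t.+1).
Proof.
move=> ab oab xab lev; apply: NNPP => nex.
have par t : a <= t -> t <= b -> odd (D (x t)) = odd (D (x a)) (+) odd (t - a).
  elim: t => [|t IH] at1 tb; first by rewrite sub0n addbF (_ : a = 0) //; lia.
  have [at2|at2] := leqP a t; last by rewrite (_ : a = t.+1) ?subnn ?addbF //; lia.
  have neq : D (x t) <> D (x t.+1) by move=> eq; apply: nex; exists t => //; lia.
  rewrite subSn //=; have := IH at2 (ltnW tb).
  have := lev t; case: (odd (t - a)) (odd (D (x a))) => -[]; lia.
by have := par b (ltnW ab) (leqnn _); rewrite -xab oab; case: (odd _).
Qed.

(** The loops [0..t] and [s..s'] are disjoint, of odd length, and attached at their double vertices.
    Each contains an edge inside a level, hence a lollipop, and the two lollipops give the dumbbell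
    forbidden by [sharp_condition]. *)
Lemma two_double_vertices M N x g L t s s' : degA e M = degA e N -> ~ conn e [::] M N ->
  sharp_condition e -> alt_walk e M N x g L -> 0 < t < s -> s < s' < L ->
  x 0 = x t -> x s = x s' -> False.
Proof.
move=> d nc sharp w ts ss' xt xs; apply: sharp.
have pr := nconn_prim d nc.
pose V : pred 'I_n := fun y => 0 < degA e M y.
pose A : pred 'I_n := fun y => [exists i : 'I_t.+1, x i == y].
pose B : pred 'I_n := fun y => [exists i : 'I_s'.+1, (s <= i) && (x i == y)].
have AP y : reflect (exists2 i, i <= t & x i = y) (A y).
  apply: (iffP existsP) => [[i /eqP <-]|[i it <-]]; first by exists i => //; rewrite -ltnS.
  by exists (Ordinal (it : i < t.+1)).
have BP y : reflect (exists2 i, s <= i <= s' & x i = y) (B y).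
  apply: (iffP existsP) => [[i /andP[si /eqP <-]]|[i /andP[si is'] <-]].
    by exists i => //; have := ltn_ord i; lia.
  by exists (Ordinal (is' : i < s'.+1)); rewrite si /=.
have Vx i : V (x i) by exact: walk_deg_gt0 d w.
have VP y : V y -> exists2 i, i < L & x i = y by exact: walk_degP d w.
have hx i : adjV e V (x i) (x i.+1).
  by apply/and3P; split; rewrite ?Vx //; apply/existsP; exists (g i); exact: aw_edge w i.
have hV y z : adjV e V y z -> V y := @adjV_V _ _ e V y z.
(* Levels are taken from [x 0] in the graph induced on the vertices of the walk, and the walk itself
   reaches each of them in fewer than [L] steps. *)
have [|D lv] := @level_fun_exists _ _ (adjV_sym e V) V (x 0) L hV.
  move=> y /VP[i iL <-]; exists i => //; elim: i {iL} => [|i IH] /=; first exact: eqxx.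
  by apply/existsP; exists (x i); rewrite hx.
have lev i : D (x i) <= (D (x i.+1)).+1 /\ D (x i.+1) <= (D (x i)).+1.
  exact: (level_adj (adjV_sym e V) lv (hx i)).
have dis i j : i <= t -> s <= j <= s' -> x i <> x j.
  move=> it sj eq; have [i0|i0] := posnP i.
    by apply: (@three_visits _ _ _ _ _ _ _ _ 0 t j pr w); rewrite -?xt -?eq ?i0 //; lia.
  have [it'|it'] := eqVneq i t.
    by apply: (@three_visits _ _ _ _ _ _ _ _ 0 t j pr w); rewrite -?eq ?it' //; lia.
  by apply: (@no_interlace _ _ _ _ _ _ _ _ i t j pr w); rewrite ?eq //; lia.
have disAB y : A y -> ~~ B y.
  by case/AP=> i it <-; apply/negP => /BP[j sj eq]; exact: (@dis i j).
have A0 : A (x 0) by apply/AP; exists 0.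
have attA : attached (adjV e V) V (x 0) A (x 0).
  split=> //; first by move=> y /AP[i _ <-].
  move=> y z /AP[i it <-] iu /and3P[hyz _ /VP[j jL zj]]; subst z.
  have [jt|tj] := leqP j t; first by apply/AP; exists j.
  have i0 : 0 < i by rewrite lt0n; apply: contraNneq iu => ->.
  have it' : i != t by apply: contraNneq iu => ->; rewrite xt.
  by move: hyz; rewrite (negPf (arc_attached d nc w _ _ xt)) //; lia.
have Bs : B (x s) by apply/BP; exists s => //; lia.
have attB : attached (adjV e V) V (x 0) B (x s).
  split=> //; first by move=> y /BP[i _ <-].
    move=> y z /BP[i si <-] iu /and3P[hyz _ /VP[j jL zj]]; subst z.
    have [js|js] := boolP (s <= j <= s'); first by apply/BP; exists j.
    have i0 : i != s by apply: contraNneq iu => ->.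
    have it' : i != s' by apply: contraNneq iu => ->; rewrite xs.
    have w' := alt_walk_shift s w.
    have d' : degA e (if odd s then N else M) = degA e (if odd s then M else N) by case: (odd s).
    have nc' : ~ conn e [::] (if odd s then N else M) (if odd s then M else N).
      by case: (odd s) => //; exact: nconn_sym.
    have xs' : x (s + 0) = x (s + (s' - s)) by rewrite addn0 subnKC //; lia.
    have nadj k : s' < k < s + L -> ~~ adj e (x i) (x k).
      move=> sk; have := @arc_attached _ _ _ _ _ (s' - s) (i - s) (k - s) d' nc' w'.
      by rewrite addn0 !subnKC //; try lia; apply=> //; lia.
    (* A time before [s] is counted one period later, to fit the walk restarted at [s]. *)
    have [js'|js'] := ltnP j s.
      by move: hyz; rewrite -(aw_x w j) (negPf (nadj _ _)) //; lia.
    by move: hyz; rewrite (negPf (nadj _ _)) //; lia.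
  by move=> B0; have := disAB _ A0; rewrite B0.
have su : x s != x 0.
  by apply/eqP => eq; apply: (@dis 0 s) => //; lia.
have ot := even_return pr w (ltac:(lia) : 0 < t < L) xt.
have os := even_return_at pr w (ltac:(lia) : s < s' < s + L) xs.
have t0 : 0 < t by lia.
have ot' : odd (t - 0) by rewrite subn0.
have ss : s < s' by lia.
have [i it Di] := level_edge t0 ot' xt lev.
have [j sj Dj] := level_edge ss os xs lev.
have irr := adjV_irr noloop V.
have Ai l : l <= t -> A (x l) by move=> lt; apply/AP; exists l.
have Bj l : s <= l <= s' -> B (x l) by move=> sl; apply/BP; exists l.
have [k [r [X [Y loA]]]] := lollipop_exists (adjV_sym e V) irr hV lv attA
  (Ai i (ltac:(lia))) (Ai i.+1 (ltac:(lia))) (hx i) Di.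
have [k' [r' [X' [Y' loB]]]] := lollipop_exists (adjV_sym e V) irr hV lv attB
  (Bj j (ltac:(lia))) (Bj j.+1 (ltac:(lia))) (hx j) Dj.
by do 5 eexists; apply: (dumbbell noloop lv attA attB disAB su loA loB).
Qed.

(** With the walk restarted at [u], the two visits of a different [v] lie in the second loop,
    interlace with those of [u], or lie in the first loop. *)
Lemma double_vertex_unique M N u v : degA e M = degA e N -> ~ conn e [::] M N ->
  sharp_condition e -> 1 < degA e M u -> 1 < degA e M v -> u = v.
Proof.
move=> d nc sharp.
wlog [x [g [L [w [t [t0 x0 xt]]]]]] : M N d nc u v / exists x g L, alt_walk e M N x g L /\
    exists t, [/\ 0 < t < L, x 0 = u & x t = u].
  move=> H hu hv; have pr := nconn_prim d nc.
  have [x [g [L w]]] := prim_walk pr.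
  have [i [j [ij jL xi xj]]] := walk_deg2P d w hu.
  have w' := alt_walk_shift i w.
  apply: (H (if odd i then N else M) (if odd i then M else N)).
  - by case: (odd i).
  - by case: (odd i) => //; exact: nconn_sym.
  - exists (fun t => x (i + t)), (fun t => g (i + t)), L; split=> //.
    by exists (j - i); rewrite addn0 subnKC ?(ltnW ij) //; split=> //; lia.
  - by rewrite fun_if -d if_same.
  - by rewrite fun_if -d if_same.
move=> hu hv; apply/eqP; apply: contraT => /eqP uv.
have pr := nconn_prim d nc.
have [s [s' [ss' sL xs xs']]] := walk_deg2P d w hv.
have nz k : x k = v -> k <> 0 /\ k <> t by move=> xk; split=> h; apply: uv; rewrite -xk h.
have [s0 s1] := nz _ xs; have [s'0 s'1] := nz _ xs'.
have xt' : x 0 = x t by rewrite x0 xt.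
have xss : x s = x s' by rewrite xs xs'.
have [st|ts] := ltnP t s.
  by case: (two_double_vertices d nc sharp w _ _ xt' xss); lia.
have [s't|ts'] := ltnP t s'.
  by case: (no_interlace pr w _ _ xt' xss); lia.
(* Both visits of [v] are in the first loop. Restarting at [s] moves the visits of [u] to [t - s]
   and [L - s], after the loop of [v]. *)
have w' := alt_walk_shift s w.
have d' : degA e (if odd s then N else M) = degA e (if odd s then M else N) by case: (odd s).
have nc' : ~ conn e [::] (if odd s then N else M) (if odd s then M else N).
  by case: (odd s) => //; exact: nconn_sym.
have [] := @two_double_vertices _ _ _ _ _ (s' - s) (t - s) (L - s) d' nc' sharp w'.
- lia.
- lia.
- by rewrite addn0 subnKC // ltnW.
- by rewrite !subnKC ?(aw_xL w) //; lia.
Qed.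

End DoubleVertices.

(** * Indispensable monomials *)

Section Indispensable.
Variables (n m : nat) (e : 'I_m -> 'I_n * 'I_n).
Hypothesis noloop : forall i, (e i).1 != (e i).2.
Hypothesis simple : forall i j, edge_is e j (e i).1 (e i).2 -> i = j.
Implicit Types (M N X Y Z P Q : 'X_{1..m}) (x : nat -> 'I_n) (g : nat -> 'I_m).

Lemma edge_inj f h u v : edge_is e f u v -> edge_is e h u v -> f = h.
Proof.
move=> hf hh; apply: simple; move: hf; rewrite /edge_is -/(edge_is e h _ _).
by case/orP=> /eqP -> //=; rewrite edge_isC.
Qed.

Lemma walk_edge_gt0 M N x g L t : alt_walk e M N x g L -> 0 < M (g t) + N (g t).
Proof.
move=> w; have := aw_gt0 (alt_walk_shift t w) (aw_pos w).
by rewrite /= addn0; case: (odd t); lia.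
Qed.

Lemma chord_even M N x g L i j f : degA e M = degA e N -> ~ conn e [::] M N ->
  alt_walk e M N x g L -> i < j < i + L -> edge_is e f (x i) (x j) ->
  M f = 0 -> N f = 0 -> ~~ odd (j - i).
Proof.
move=> d nc w ij hf Mf Nf; apply/negP => o.
have [eq|eq] := odd_chord_at d nc w ij o hf.
  have := walk_edge_gt0 i w; have := aw_edge w i; rewrite -eq => he.
  by rewrite -(edge_inj hf he); lia.
have := walk_edge_gt0 j w; have := aw_edge w j.
have -> : j.+1 = i + L by lia.
by rewrite (aw_x w) edge_isC => he; rewrite -(edge_inj hf he); lia.
Qed.

Lemma visits_deg M N x g L i j : degA e M = degA e N -> alt_walk e M N x g L ->
  i < j < L -> x i = x j -> 1 < degA e M (x i).
Proof.
move=> d w ij xij; have iL : i < L by lia.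
have jL : j < L by lia.
rewrite (walk_deg _ d w) (bigD1 (Ordinal iL)) //= (bigD1 (Ordinal jL)) /=; last first.
  by rewrite -val_eqE /=; lia.
by rewrite -xij eqxx; lia.
Qed.

Lemma mdeg_seg (g : nat -> 'I_m) L : mdeg (seg false g 0 L) + mdeg (seg true g 0 L) = L.
Proof.
elim: L => [|L IH]; first by rewrite !seg_nil !mdeg0.
rewrite !seg_recr // !mdegD; move: IH.
by case: (odd L); rewrite /= mdeg1 mdeg0; lia.
Qed.

Lemma walk_length M N x g L : degA e M = degA e N -> alt_walk e M N x g L -> L = (mdeg M).*2.
Proof.
move=> d w; have := mdeg_seg g L; rewrite -(aw_M w) -(aw_N w) -(degA_mdeg d); lia.
Qed.

(* the minimal monomials among those occurring in a nonzero binomial of the ideal *)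
Definition indisp M :=
  (exists2 N, N <> M & degA e N = degA e M) /\
  (forall M' Y, M = (M' + Y)%MM -> Y != 0%MM -> forall N', degA e N' = degA e M' -> N' = M').

(** Removing a shared variable would leave a proper divisor of [M] with a partner in its fiber, so
    [M] is alone in its component. *)
Lemma indisp_conn M Z : indisp M -> conn e [::] M Z -> Z = M.
Proof.
move=> iM c; move: iM; elim: c => // {}M N {}Z st _ IH iM.
suff NM : N = M by rewrite NM in IH; rewrite IH.
case: st => // -[d [i /andP[/mnm_split[M' eM] /mnm_split[N' eN]]]].
have U0 : U_(i)%MM != 0%MM :> 'X_{1..m} by rewrite mnm1_eq0.
have [_ h] := iM; rewrite eN eM; congr (_ + _)%MM.
apply: (h M' U_(i)%MM) => //; first by rewrite addmC.
by apply: (@addmI _ (degA e U_(i))); rewrite -!degAD -eN -eM.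
Qed.

Lemma indisp_nconn M N : indisp M -> N <> M -> ~ conn e [::] M N.
Proof. by move=> iM NM /(indisp_conn iM). Qed.

Lemma nconn_disjoint M N i : degA e M = degA e N -> ~ conn e [::] M N -> 0 < M i -> N i = 0.
Proof.
move=> d nc Mi; apply/eqP; rewrite -leqn0 leqNgt; apply/negP => Ni; apply: nc.
exact: conn_share Mi Ni.
Qed.

Lemma exists_indisp X Y : degA e X = degA e Y -> X <> Y ->
  exists M Z, indisp M /\ X = (M + Z)%MM.
Proof.
move: {2}(mdeg X).+1 (ltnSn (mdeg X)) => s; elim: s X Y => // s IH X Y hs d XY.
have [iX|niX] := classic (indisp X); first by exists X, 0%MM; rewrite addm0.
have [M' [Y' [N' [eX Y'0 dN' N'M']]]] :
    exists M' Y' N', [/\ X = (M' + Y')%MM, Y' != 0%MM, degA e N' = degA e M' & N' <> M'].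
  apply: NNPP => nex; apply: niX; split; first by exists Y => // YX; apply: XY.
  move=> M' Y' eX Y'0 N' dN'; apply: NNPP => neq; apply: nex.
  by exists M', Y', N'.
have [|//|M [Z [iM eM']]] := IH M' N' _ (esym dN').
- move: hs; rewrite eX mdegD ltnS; apply: leq_trans.
  by rewrite -addn1 leq_add2l lt0n mdeg_eq0.
- by move=> h; apply: N'M'.
- by exists M, (Z + Y')%MM; rewrite addmA -eM'.
Qed.

(** Proper divisors have degree at most one, and in a simple graph an edge is determined by its
    ends. *)
Lemma indisp_quadratic M : mdeg M = 2 -> (exists2 N, N <> M & degA e N = degA e M) -> indisp M.
Proof.
move=> M2 ex; split=> // M' Y eM Y0 N' dN'.
have md := degA_mdeg dN'.
have : mdeg M' <= 1.
  by move: M2 Y0; rewrite eM mdegD -mdeg_eq0; lia.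
rewrite leq_eqVlt ltnS leqn0 => /orP[/mdeg1P[i /eqP ei]|]; last first.
  by move=> h; move: (h); rewrite -md !mdeg_eq0 => /eqP ->; move: h; rewrite mdeg_eq0 => /eqP ->.
have : mdeg N' == 1 by rewrite md ei mdeg1.
case/mdeg1P=> j /eqP ej; move: dN'; rewrite ei ej !degAU => dN'.
congr U_(_)%MM; apply/esym/simple; rewrite /edge_is [e j]surjective_pairing !xpair_eqE.
have := congr1 (fun D : 'X_{1..n} => (D (e i).1, D (e i).2)) dN'.
rewrite !mnmDE !mnm1E !eqxx => -[].
have nl := noloop i; rewrite [(e i).2 == (e i).1]eq_sym (negPf nl) => h1 h2.
have nb u : ~~ ((u == (e i).1) && (u == (e i).2)).
  by apply: contra nl => /andP[/eqP <- /eqP <-].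
have := nb (e j).1; have := nb (e j).2; move: h1 h2 => /=; lia.
Qed.

Hypothesis sharp : sharp_condition e.

(** A repeated edge would make both of its ends double vertices. *)
Lemma nconn_squarefree M N i : degA e M = degA e N -> ~ conn e [::] M N -> M i <= 1.
Proof.
move=> d nc; rewrite leqNgt; apply/negP => Mi.
have h v : (e i).1 = v \/ (e i).2 = v -> 1 < degA e M v.
  move=> hv; rewrite degAE (bigD1 i) //=; apply: ltn_addr.
  by apply: leq_trans Mi _; rewrite -{1}[M i]mul1n leq_mul2r; case: hv => ->; rewrite eqxx; lia.
have := double_vertex_unique noloop d nc sharp (h _ (or_introl erefl)) (h _ (or_intror erefl)).
by move=> eq; have := noloop i; rewrite eq eqxx.
Qed.

Lemma indisp_squarefree M i : indisp M -> M i <= 1.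
Proof.
move=> iM; have [[N NM d] _] := iM.
exact: nconn_squarefree (esym d) (indisp_nconn iM NM).
Qed.

(** [X] is a multiple of some [M'] satisfying [indisp]. Being squarefree and supported in [M], this
    [M'] divides [M], and minimality of [M] gives equality. *)
Lemma indisp_min M X Y : indisp M -> degA e X = degA e Y -> X <> Y ->
  (forall i, 0 < X i -> 0 < M i) -> exists Z, X = (M + Z)%MM.
Proof.
move=> iM d XY sub; have [M' [Z [iM' eX]]] := exists_indisp d XY.
have le : (M' <= M)%MM.
  apply/mnm_lepP => i; have := indisp_squarefree i iM'.
  have := sub i; rewrite eX mnmDE; lia.
have := submK le; rewrite addmC => eM.
have [W0|W0] := eqVneq (M - M')%MM 0%MM.
  by exists Z; rewrite eX -eM W0 addm0.
have [[N NM' dN] _] := iM'; case: iM => _ /(_ _ _ (esym eM) W0 _ dN) //.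
Qed.

Lemma sub_deg_gt0 M Z v : (forall i, 0 < M i -> 0 < Z i) -> 0 < degA e M v -> 0 < degA e Z v.
Proof.
by move=> sub /degA_gt0P[i [y [Mi hi]]]; exact: degA_gt0_edge hi (sub i Mi).
Qed.

Lemma prim_sub X Y : degA e X = degA e Y -> X != 0%MM ->
  exists X1 X2 Y1 Y2, [/\ X = (X1 + X2)%MM, Y = (Y1 + Y2)%MM & prim e X1 Y1].
Proof.
move: {2}(mdeg X).+1 (ltnSn (mdeg X)) => s; elim: s X Y => // s IH X Y hs d X0.
have [pr|npr] := classic (prim e X Y); first by exists X, 0%MM, Y, 0%MM; rewrite !addm0.
have [A [A' [B [B' [eX eY dAB [A0 A'0]]]]]] :
    exists A A' B B', [/\ X = (A + A')%MM, Y = (B + B')%MM, degA e A = degA e B &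
      A != 0%MM /\ A' != 0%MM].
  apply: NNPP => nex; apply: npr; split=> // A A' B B' eX eY dAB A0.
  have A'0 : A' = 0%MM.
    by apply/eqP; apply: contra_notT nex => A'0; exists A, A', B, B'.
  split=> //; apply: (@degA_eq0 _ _ e); apply: (@addmI _ (degA e B)).
  by rewrite -degAD -eY -d eX A'0 !addm0.
have [|X1 [X2 [Y1 [Y2 [eA eB pr]]]]] := IH A B _ dAB A0.
  move: hs; rewrite eX mdegD ltnS; apply: leq_trans.
  by rewrite -addn1 leq_add2l lt0n mdeg_eq0.
by exists X1, (X2 + A')%MM, Y1, (Y2 + B')%MM; split; rewrite // addmA -?eA -?eB.
Qed.

(** The walk is restarted at a visit of the double vertex [v], so that [no_covering_chord] applies
    to [f]. *)
Lemma covering_edge X Y v z f : prim e X Y -> 1 < degA e X v -> 0 < degA e X z ->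
  edge_is e f v z ->
  (forall P P' Q, X = (P + P')%MM -> degA e P = degA e Q -> P <> Q ->
     forall w, 0 < degA e X w -> 0 < degA e P w) ->
  (forall P P' Q, Y = (P + P')%MM -> degA e P = degA e Q -> P <> Q ->
     forall w, 0 < degA e X w -> 0 < degA e P w) -> 0 < X f + Y f.
Proof.
move=> pr hv hz hf cX cY; rewrite lt0n; apply/negP; rewrite addn_eq0 => /andP[/eqP Xf /eqP Yf].
have [d _ _] := pr; have [x [g [L w]]] := prim_walk pr.
have [i [j [ij jL xi xj]]] := walk_deg2P d w hv.
have w' := alt_walk_shift i w.
have Vx t : 0 < degA e X (x t) := walk_deg_gt0 t d w.
have [s0 s0L xs0] : exists2 s, s < L & x (i + s) = z.
  have [s sL xs] := walk_degP d w hz.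
  have [si|is_] := ltnP s i.
    exists (s + L - i); first by lia.
    by rewrite subnKC ?(aw_x w) //; lia.
  by exists (s - i); [lia | rewrite subnKC].
have hf' : edge_is e f (x (i + 0)) (x (i + s0)) by rewrite addn0 xs0 xi.
have h0 : 0 < j - i < L by lia.
have x0 : x (i + 0) = x (i + (j - i)) by rewrite addn0 subnKC 1?ltnW // xi xj.
have pr' : prim e (if odd i then Y else X) (if odd i then X else Y).
  by case: (odd i) => //; exact: prim_sym.
apply: (no_covering_chord noloop pr' w' h0 x0 s0L hf').
- by case: (odd i).
- by case: (odd i).
- by case: (odd i) => P P' Q eP dP PQ r; [apply: cY eP dP PQ _ _ | apply: cX eP dP PQ _ _].
- by case: (odd i) => P P' Q eP dP PQ r; [apply: cX eP dP PQ _ _ | apply: cY eP dP PQ _ _].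
Qed.

Lemma two_edges M v : (forall i, M i <= 1) -> 1 < degA e M v ->
  exists i j yi yj, [/\ i != j, 0 < M i, 0 < M j & edge_is e i v yi /\ edge_is e j v yj].
Proof.
move=> sq hv; have [i [yi [Mi hi]]] := degA_gt0P (ltnW hv).
have [M' eM] := mnm_split Mi.
have : 0 < degA e M' v.
  move: hv; rewrite eM degAD_eval (degA_edgeE v hi) eqxx.
  by have := edge_neq noloop hi; rewrite eq_sym => /negPf ->; lia.
case/degA_gt0P=> j [yj [M'j hj]]; exists i, j, yi, yj; split=> //.
  apply: contraTneq M'j => <-; have := sq i; rewrite eM mnmDE mnm1E eqxx; lia.
by rewrite eM mnmDE; lia.
Qed.

Lemma deg2_edges M v i j yi yj : i != j -> 0 < M i -> 0 < M j ->
  edge_is e i v yi -> edge_is e j v yj -> 1 < degA e M v.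
Proof.
move=> ij /mnm_split[M' ->]; rewrite mnmDE mnm1E (negPf ij) add0n => M'j hi hj.
have := degA_gt0_edge hj M'j.
by rewrite degAD_eval (degA_edgeE v hi) eqxx; lia.
Qed.

(** Another monomial [M1] in the fiber of [M] has two edges at [v]. They join [v] to vertices of
    [X], hence occur in [X] or [Y] by [covering_edge]; being absent from [M] they occur in [Y], that
    is, in [N]. *)
Lemma indisp_double M N X Y v : indisp M -> indisp N -> prim e X Y ->
  (forall i, (0 < X i) = (0 < M i)) -> (forall i, (0 < Y i) = (0 < N i)) ->
  1 < degA e M v -> 1 < degA e N v.
Proof.
move=> iM iN pr sX sY hv; have [d _ _] := pr.
have [[M1 M1M dM1] _] := iM.
have nc := indisp_nconn iM M1M.
have degX u : (0 < degA e X u) = (0 < degA e M u).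
  by apply/idP/idP; apply: sub_deg_gt0 => i; rewrite sX.
have degY u : (0 < degA e X u) = (0 < degA e N u).
  by rewrite d; apply/idP/idP; apply: sub_deg_gt0 => i; rewrite sY.
have cX P P' Q : X = (P + P')%MM -> degA e P = degA e Q -> P <> Q ->
     forall w, 0 < degA e X w -> 0 < degA e P w.
  move=> eX dP PQ w; rewrite degX; have [|Z ->] := indisp_min iM dP PQ.
    by move=> i Pi; rewrite -sX eX mnmDE; lia.
  by rewrite degAD_eval; lia.
have cY P P' Q : Y = (P + P')%MM -> degA e P = degA e Q -> P <> Q ->
     forall w, 0 < degA e X w -> 0 < degA e P w.
  move=> eY dP PQ w; rewrite degY; have [|Z ->] := indisp_min iN dP PQ.
    by move=> i Pi; rewrite -sY eY mnmDE; lia.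
  by rewrite degAD_eval; lia.
have hX : 1 < degA e X v.
  have [i [j [yi [yj [ij Mi Mj [hi hj]]]]]] := two_edges (fun i => indisp_squarefree i iM) hv.
  by apply: (deg2_edges ij _ _ hi hj); rewrite sX.
have sq1 i : M1 i <= 1 by apply: (nconn_squarefree i dM1); exact: nconn_sym.
have hv1 : 1 < degA e M1 v by rewrite dM1.
have [i [j [yi [yj [ij Mi Mj [hi hj]]]]]] := two_edges sq1 hv1.
have Nf f y : 0 < M1 f -> edge_is e f v y -> 0 < N f.
  move=> M1f hf.
  have hy : 0 < degA e X y.
    by rewrite degX -dM1; move: hf; rewrite edge_isC => hf; exact: degA_gt0_edge hf M1f.
  have := covering_edge pr hX hy hf cX cY.
  have Mf : M f = 0 by apply: nconn_disjoint M1f => //; exact: nconn_sym.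
  by have := sX f; rewrite Mf -sY; lia.
exact: (deg2_edges ij (Nf _ _ Mi hi) (Nf _ _ Mj hj) hi hj).
Qed.

Lemma indisp_deg_le2 M v : indisp M -> degA e M v <= 2.
Proof.
move=> iM; have [[N NM d] _] := iM.
have pr := nconn_prim (esym d) (indisp_nconn iM NM).
by have [x [g [L w]]] := prim_walk pr; exact: walk_deg_le2 pr w.
Qed.

(** All degrees of [M] and [N] are at most 2, they are positive at the same vertices, and by
    [indisp_double] they equal 2 at the same vertices. *)
Lemma indisp_same_deg M N X Y : indisp M -> indisp N -> degA e X = degA e Y -> X <> Y ->
  (forall i, (0 < X i) = (0 < M i)) -> (forall i, (0 < Y i) = (0 < N i)) ->
  degA e M = degA e N.
Proof.
move=> iM iN d XY sX sY.
(* Dividing by the gcd makes the two sides coprime, so that a primitive pair inside them has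
   distinct members; by [indisp_min] this pair still has the supports of [M] and [N]. *)
pose G := [multinom minn (X i) (Y i) | i < m].
have eX : X = (G + (X - G))%MM by rewrite addmC submK //; apply/mnm_lepP => i; rewrite mnmE geq_minl.
have eY : Y = (G + (Y - G))%MM by rewrite addmC submK //; apply/mnm_lepP => i; rewrite mnmE geq_minr.
have dG : degA e (X - G)%MM = degA e (Y - G)%MM.
  by apply: (@addmI _ (degA e G)); rewrite -!degAD -eX -eY.
have XG0 : (X - G)%MM != 0%MM.
  apply/eqP => h; apply: XY; rewrite eX eY h.
  by rewrite (_ : (Y - G)%MM = 0%MM) //; apply: (@degA_eq0 _ _ e); rewrite -dG h degA0.
have [X1 [X2 [Y1 [Y2 [eX1 eY1 pr]]]]] := prim_sub dG XG0.
have [d1 X10 _] := pr.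
have XY1 : X1 <> Y1.
  move=> eq; have /mnm_neq0P[i Xi] := X10.
  have := congr1 (fun Z : 'X_{1..m} => Z i) eX1; have := congr1 (fun Z : 'X_{1..m} => Z i) eY1.
  by rewrite -eq !mnmDE !mnmBE !mnmE; lia.
have [|Z eZ] := indisp_min iM d1 XY1.
  by move=> i Xi; rewrite -sX eX eX1 !mnmDE; lia.
have [|W eW] := indisp_min iN (esym d1) (fun h => XY1 (esym h)).
  by move=> i Yi; rewrite -sY eY eY1 !mnmDE; lia.
have sX1 i : (0 < X1 i) = (0 < M i).
  apply/idP/idP; last by rewrite eZ mnmDE; lia.
  by rewrite -sX eX eX1 !mnmDE; lia.
have sY1 i : (0 < Y1 i) = (0 < N i).
  apply/idP/idP; last by rewrite eW mnmDE; lia.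
  by rewrite -sY eY eY1 !mnmDE; lia.
apply/mnmP => v.
have l1 := indisp_deg_le2 v iM; have l2 := indisp_deg_le2 v iN.
have h1 : 1 < degA e M v -> 1 < degA e N v := indisp_double iM iN pr sX1 sY1.
have h2 : 1 < degA e N v -> 1 < degA e M v := indisp_double iN iM (prim_sym pr) sY1 sX1.
have h3 : (0 < degA e M v) = (0 < degA e N v).
  apply/idP/idP => h.
    apply: (@sub_deg_gt0 Y1) => [i|]; first by rewrite sY1.
    by rewrite -d1; apply: sub_deg_gt0 h => i; rewrite sX1.
  apply: (@sub_deg_gt0 X1) => [i|]; first by rewrite sX1.
  by rewrite d1; apply: sub_deg_gt0 h => i; rewrite sY1.
lia.
Qed.

End Indispensable.

(** * The components of a fiber *)

Section FiberStructure.
Variables (n m : nat) (e : 'I_m -> 'I_n * 'I_n).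
Hypothesis noloop : forall i, (e i).1 != (e i).2.
Hypothesis simple : forall i j, edge_is e j (e i).1 (e i).2 -> i = j.
Implicit Types (M N X Y Z P Q : 'X_{1..m}) (x : nat -> 'I_n) (g : nat -> 'I_m).
Implicit Types (S : seq ('X_{1..m} * 'X_{1..m})).

(* The edges of P are chords of the closed walk of (M, N) that preserve parity;
   a shortest one must be interlaced with one of the other parity. *)
Lemma indisp_three M N P : indisp e M -> indisp e N -> degA e M = degA e N -> M <> N ->
  degA e M = degA e P -> P <> M -> P <> N -> mdeg M = 2.
Proof.
move=> iM iN d MN dP PM PN.
have nc := indisp_nconn iM (fun h => MN (esym h)).
have pr := nconn_prim d nc; have [x [g [L w]]] := prim_walk pr.
suff L4 : L = 4 by have := walk_length d w; lia.
have PfM f : 0 < P f -> M f = 0.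
  move=> Pf; apply: (nconn_disjoint (esym dP) _ Pf); apply: nconn_sym; exact: indisp_nconn.
have PfN f : 0 < P f -> N f = 0.
  move=> Pf; apply: (@nconn_disjoint _ _ e P N _ _ _ Pf); first by rewrite -dP.
  by apply: nconn_sym; exact: indisp_nconn.
have partner t : exists f s, [/\ s < L, 0 < P f, edge_is e f (x t) (x s) & x t != x s].
  have [|f [y [Pf hf]]] := @degA_gt0P _ _ e P (x t).
    by rewrite -dP; exact: walk_deg_gt0 d w.
  have [|s sL xs] := @walk_degP _ _ e M N x g L y d w.
    by rewrite dP; move: hf; rewrite edge_isC => hf; exact: degA_gt0_edge hf Pf.
  by exists f, s; rewrite xs; split=> //; exact: edge_neq hf.
have even_chord i j f : i < j < i + L -> 0 < P f -> edge_is e f (x i) (x j) -> ~~ odd (j - i).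
  by move=> ij Pf hf; exact: (chord_even simple d nc w ij hf (PfM _ Pf) (PfN _ Pf)).
have main k s u f : u - s < k -> s < u < L -> 0 < P f -> edge_is e f (x s) (x u) -> L = 4.
  elim: k s u f => // k IH s u f hk su Pf hf.
  have ev := even_chord s u f (ltac:(lia)) Pf hf.
  (* The edge of [P] at the vertex after [s] ends strictly between [s] and [u], giving a shorter
     chord, or outside, giving an interlaced one; parity excludes [s] and [u]. *)
  have [f' [w' [w'L Pf' hf' nw']]] := partner s.+1.
  have ws : w' != s.+1 by apply: contraNneq nw' => ->.
  have par : odd w' = odd s.+1.
    have [h|h] := ltnP s.+1 w'.
      by have := even_chord _ _ _ (ltac:(lia) : s.+1 < w' < s.+1 + L) Pf' hf'; lia.
    move: hf'; rewrite edge_isC => hf'.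
    by have := even_chord _ _ _ (ltac:(lia) : w' < s.+1 < w' + L) Pf' hf'; lia.
  have [sw|ws'] := boolP (s < w' < u).
    by apply: (IH s.+1 w' f') => //; lia.
  have wk := alt_walk_shift s w.
  have [r [r1 r2 r3]] : exists r, [/\ u - s < r < L, odd r & x (s + r) = x w'].
    have [h|h] := ltnP w' s.
      by exists (w' + L - s); rewrite subnKC ?(aw_x w) //; [split=> //|]; have := aw_even w; lia.
    by exists (w' - s); rewrite subnKC //; split=> //; lia.
  have hf0 : edge_is e f (x (s + 0)) (x (s + (u - s))) by rewrite addn0 subnKC //; lia.
  have hf1 : edge_is e f' (x (s + 1)) (x (s + r)) by rewrite addn1 r3.
  have c1 : 0 < 1 < u - s by lia.
  move: wk; case: (odd s) => wk.
    by apply: (cross_chords (esym d) _ _ wk c1 r1 _ ev r2 hf0 hf1) => // [Z|Z||];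
      [exact: indisp_conn | exact: indisp_conn | exact: PfN | exact: PfM].
  by apply: (cross_chords d _ _ wk c1 r1 _ ev r2 hf0 hf1) => // [Z|Z||];
      [exact: indisp_conn | exact: indisp_conn | exact: PfM | exact: PfN].
have [f [s [sL Pf hf ns]]] := partner 0.
have s0 : 0 < s by rewrite lt0n; apply: contraNneq ns => ->.
by apply: (main (s - 0).+1 0 s f) => //; lia.
Qed.

Hypothesis dichotomy : forall M N, degA e M = degA e N -> ~ conn e [::] M N ->
  indisp e M \/ indisp e N.

(** In degree 2 the walk has length 4, and any further monomial of the fiber must contain the
    diagonal from [x 0] to [x 2]. Thus [P] and [Q] share an edge, although [P] is alone in its
    component. *)
Lemma no_four M N P Q : indisp e M -> indisp e N -> indisp e P ->
  degA e M = degA e N -> degA e M = degA e P -> degA e M = degA e Q ->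
  M <> N -> P <> M -> P <> N -> Q <> M -> Q <> N -> Q <> P -> False.
Proof.
move=> iM iN iP dN dP dQ MN PM PN QM QN QP.
have M2 := indisp_three iM iN dN MN dP PM PN.
have nc := indisp_nconn iM (fun h => MN (esym h)).
have pr := nconn_prim dN nc; have [x [g [L w]]] := prim_walk pr.
have L4 : L = 4 by have := walk_length dN w; lia.
have key R : degA e M = degA e R -> R <> M -> R <> N ->
    exists2 f, 0 < R f & edge_is e f (x 0) (x 2).
  move=> dR RM RN.
  have [|f [y [Rf hf]]] := @degA_gt0P _ _ e R (x 0).
    by rewrite -dR; exact: walk_deg_gt0 dN w.
  have [|s sL xs] := @walk_degP _ _ e M N x g L y dN w.
    by rewrite dR; move: hf; rewrite edge_isC => hf; exact: degA_gt0_edge hf Rf.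
  exists f => //.
  have s0 : 0 < s by rewrite lt0n; apply: contraTneq (edge_neq noloop hf) => s0; rewrite -xs s0 eqxx.
  have Mf : M f = 0.
    apply: (nconn_disjoint (esym dR) _ Rf); apply: nconn_sym; exact: indisp_nconn.
  have Nf : N f = 0.
    apply: (@nconn_disjoint _ _ e R N _ _ _ Rf); first by rewrite -dR.
    by apply: nconn_sym; exact: indisp_nconn.
  rewrite -xs in hf.
  have := chord_even simple dN nc w (ltac:(lia) : 0 < s < 0 + L) hf Mf Nf.
  by move=> ev; rewrite (_ : 2 = s) //; lia.
have [f Pf hf] := key P dP PM PN; have [h Qh hh] := key Q dQ QM QN.
apply: QP; apply: (indisp_conn iP); rewrite -(edge_inj simple hf hh) in Qh.
by apply: (conn_share _ _ Pf Qh); rewrite -dP.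
Qed.

(** Suppose [S] leaves [M] and [N] apart, with [M] linked to [P]. Then [N] and [P] are apart too,
    the three components force degree 2, and so [N] and [P] also satisfy [indisp]. The partner [Q]
    of [N] is then a fourth monomial, against [no_four]. *)
Lemma indisp_links_conn S : (forall M N, (M, N) \in S -> degA e M = degA e N) ->
  (forall M, indisp e M -> exists2 N, N <> M & ((M, N) \in S) || ((N, M) \in S)) ->
  forall M N, degA e M = degA e N -> conn e S M N.
Proof.
move=> hS link M N d; apply: NNPP => nS.
wlog iM : M N d nS / indisp e M.
  move=> H; have nc : ~ conn e [::] M N by move=> h; apply: nS; exact: conn0_sub.
  have [iM|iN] := dichotomy d nc; first exact: (H M N).
  by apply: (H N M) => // h; apply: nS; exact: conn_sym.
have linked P : indisp e P -> exists Q, [/\ Q <> P, degA e P = degA e Q & conn e S P Q].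
  move=> iP; have [Q QP /orP[h|h]] := link P iP; exists Q; split=> //.
  - exact: hS.
  - exact: conn_mem.
  - exact/esym/hS.
  - exact/conn_sym/conn_mem.
have [P [PM dP cP]] := linked M iM.
have NM : N <> M by move=> h; apply: nS; rewrite h; exact: conn_refl.
have PN : P <> N by move=> h; apply: nS; rewrite -h.
have nPN : ~ conn e [::] P N by move=> /(conn0_sub S) h; apply: nS; exact: conn_trans cP h.
have M2 : mdeg M = 2.
  have dPN : degA e P = degA e N by rewrite -dP.
  have [iP|iN] := dichotomy dPN nPN.
    by apply: (@indisp_three M P N) => // h; [apply: PM | apply: PN].
  by apply: (@indisp_three M N P) => // h; apply: NM.
have quad R : degA e M = degA e R -> R <> M -> indisp e R.
  move=> dR RM; apply: indisp_quadratic => //; first by rewrite -(degA_mdeg dR).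
  by exists M; [move=> h; apply: RM|].
have iN := quad N d NM; have iP := quad P dP PM.
have [Q [QN dQ cQ]] := linked N iN.
have QM : Q <> M by move=> h; apply: nS; rewrite -h; exact: conn_sym.
have QP : Q <> P.
  by move=> h; apply: nS; apply: (conn_trans cP); rewrite -h; exact: conn_sym.
apply: (@no_four M N P Q) => //; first by rewrite d.
by move=> h; apply: NM.
Qed.

End FiberStructure.

(** * Disconnected pairs are circuits *)

Section Circuits.
Import GRing.Theory Num.Theory Order.TTheory.
Variables (n m : nat) (e : 'I_m -> 'I_n * 'I_n).
Hypothesis noloop : forall i, (e i).1 != (e i).2.
Implicit Types (M N : 'X_{1..m}) (x : nat -> 'I_n) (g : nat -> 'I_m).

Let inc (i : 'I_m) (v : 'I_n) := ((e i).1 == v) || ((e i).2 == v).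

Lemma inc_edge i a b v : edge_is e i a b -> inc i v = (a == v) || (b == v).
Proof. by rewrite /inc => /orP[] /eqP -> //=; rewrite orbC. Qed.

Lemma degA_inc M v : degA e M v = \sum_(i < m | inc i v) M i.
Proof.
rewrite degAE [RHS]big_mkcond /=; apply: eq_bigr => i _; rewrite /inc.
case: eqP => [<-|_]; case: eqP => [h|_] //=; rewrite ?mul1n ?mul0n //.
by have := noloop i; rewrite h eqxx.
Qed.

Lemma sum_walk (F : 'I_m -> int) g k :
  (\sum_(t < k) F (g t) = \sum_i F i *+ (seg false g 0 k i + seg true g 0 k i))%R.
Proof.
elim: k => [|k IH].
  by rewrite big_ord0 big1 // => i _; rewrite !seg_nil !mnm0E.
rewrite big_ord_recr IH /= (bigD1 (g k)) //= [in RHS](bigD1 (g k)) //= addrAC.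
congr (_ + _)%R.
  rewrite !seg_recr // !mnmDE; case: (odd k); rewrite /= mnm1E eqxx mnm0E addn0.
    by rewrite addn1 addnS mulrSr.
  by rewrite addn1 addSn mulrSr.
apply: eq_bigr => i ik; rewrite !seg_recr // !mnmDE.
by case: (odd k); rewrite /= mnm1E mnm0E eq_sym (negPf ik) !addn0.
Qed.

(** The kernel equation at [y], read along the walk: edges in the support of [v] are traversed once.
    By periodicity [g (t + L.-1)] is the edge entering [x t], also for [t = 0]. *)
Lemma ker_walk M N x g L (v : 'I_m -> int) (y : 'I_n) : alt_walk e M N x g L ->
  in_kerA e v -> (forall i, v i != 0%R -> M i + N i = 1) ->
  (\sum_(t < L | x t == y) (v (g t) + v (g (t + L.-1)%N)) = 0)%R.
Proof.
move=> w kv vs; have L0 := aw_pos w.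
pose F i := (v i *+ inc i y)%R.
have E1 : (\sum_(t < L) F (g t) = 0)%R.
  rewrite sum_walk -(aw_M w) -(aw_N w) -[RHS](kv y) [RHS]big_mkcond /=.
  apply: eq_bigr => i _; rewrite /F -/(inc i y).
  have [->|vi] := eqVneq (v i) 0%R; first by rewrite !mul0rn if_same.
  by rewrite vs // mulr1n; case: (inc i y); rewrite ?mulr1n ?mulr0n.
have E2 t : F (g t) = (v (g t) *+ (x t == y) + v (g t) *+ (x t.+1 == y))%R.
  have he := aw_edge w t; rewrite /F (inc_edge y he) -mulrnDr.
  case: eqP => [<-|_] //=; have := edge_neq noloop he.
  by rewrite eq_sym => /negPf ->.
transitivity (\sum_(t < L) (v (g t) *+ (x t == y) + v (g t) *+ (x t.+1 == y)))%R; last first.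
  by rewrite -[RHS]E1; apply: eq_bigr => t _; rewrite E2.
rewrite !big_split /=; congr (_ + _)%R.
  by rewrite big_mkcond; apply: eq_bigr => t _; case: eqP.
pose G t := (v (g (t + L.-1)%N) *+ (x t == y))%R.
transitivity (\sum_(0 <= t < L) G t)%R.
  by rewrite big_mkcond big_mkord; apply: eq_bigr => t _; rewrite /G; case: eqP.
have GL : G L = G 0.
  rewrite /G (aw_xL w); congr (v _ *+ _)%R.
  by rewrite addnC (aw_g w).
transitivity (\sum_(0 <= t < L) G t.+1)%R.
  have : (\sum_(0 <= t < L.+1) G t = \sum_(0 <= t < L) G t + G L)%R by rewrite big_nat_recr.
  by rewrite big_nat_recl //= GL addrC => /addIr.
rewrite big_mkord; apply: eq_bigr => t _; rewrite /G.
by rewrite (_ : t.+1 + L.-1 = t + L) ?(aw_g w) //; lia.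
Qed.

Lemma alternating (v : nat -> int) a b : a < b ->
  (forall i, a < i < b -> (v i + v i.-1 = 0)%R) ->
  forall i, a <= i < b -> v i = if odd (i - a) then (- v a)%R else v a.
Proof.
move=> ab h; elim=> [|i IH] hi; first by rewrite (_ : a = 0) //; lia.
have [ai|ai] := leqP a i; last by rewrite (_ : a = i.+1) ?subnn //; lia.
have := h i.+1 (ltac:(lia)); rewrite /= IH; last lia.
rewrite subSn //=; case: (odd _) => /= /eqP; rewrite addr_eq0 ?opprK => /eqP //.
Qed.

(** The kernel equation makes [v] change sign at each vertex visited once, so its values along the
    walk agree up to sign; only the double vertex at time 0 needs a separate argument. *)
Lemma ker_walk_const M N x g L (v : 'I_m -> int) : alt_walk e M N x g L ->
  in_kerA e v -> (forall i, v i != 0%R -> M i + N i = 1) ->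
  (forall i j, i < j < L -> x i = x j -> i = 0) ->
  (forall j k, 0 < j < L -> 0 < k < L -> x 0 = x j -> x 0 = x k -> j = k /\ odd j) ->
  forall t, t < L -> (v (g t) == 0%R) = (v (g 0) == 0%R).
Proof.
move=> w kv vs inj dbl; have L0 := aw_pos w; have oL := aw_even w.
have W t : 0 < t < L -> x t <> x 0 -> (v (g t) + v (g t.-1) = 0)%R.
  move=> tL xt; have tL' : t < L by lia.
  have := ker_walk (x t) w kv vs; rewrite (big_pred1 (Ordinal tL')) /=.
    by rewrite (_ : t + L.-1 = t.-1 + L) ?(aw_g w) //; lia.
  move=> i /=; apply/eqP/eqP => [xit|->//]; apply: val_inj => /=.
  have iL := ltn_ord i.
  have [h|h|//] := ltngtP i t.
    by have i0 := inj i t (ltac:(lia)) xit; case: xt; rewrite -xit i0.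
  by have t0 := inj t i (ltac:(lia)) (esym xit); lia.
have W0 := ker_walk (x 0) w kv vs.
have [[j [j0 xj]]|nd] := classic (exists j, 0 < j < L /\ x 0 = x j).
  have [_ oj] := dbl j j j0 j0 xj xj.
  have jL : j < L by lia.
  have nj t : 0 < t < L -> t != j -> x t <> x 0.
    by move=> t0 tj xt; have [tj' _] := dbl t j t0 j0 (esym xt) xj; rewrite tj' eqxx in tj.
  have A1 := @alternating (fun t => v (g t)) 0 j (ltac:(lia))
     (fun i hi => W i (ltac:(lia)) (nj i (ltac:(lia)) (ltac:(lia)))).
  have A2 := @alternating (fun t => v (g t)) j L jL
     (fun i hi => W i (ltac:(lia)) (nj i (ltac:(lia)) (ltac:(lia)))).
  (* Both loops have odd length, so each begins and ends with the same value; the equation at the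
     double vertex becomes twice [v (g 0) + v (g j) = 0]. *)
  move: W0; rewrite (bigD1 (Ordinal L0)) //= (bigD1 (Ordinal jL)) /=; last first.
    by rewrite -xj eqxx -val_eqE /=; lia.
  rewrite big1; last first.
    move=> i /andP[/andP[/eqP xi]]; rewrite -!val_eqE /= => i0 ij.
    by case: (nj i); rewrite ?xi //; have := ltn_ord i; lia.
  have jL1 : j + L.-1 = j.-1 + L by clear -j0; lia.
  have o1 : odd (L.-1 - j) = false by clear -oj oL jL; lia.
  have o2 : odd (j.-1 - 0) = false by clear -oj j0; lia.
  rewrite addr0 add0n jL1 (aw_g w) (A2 L.-1) ?(A1 j.-1) ?o1 ?o2; try by clear -j0; lia.
  rewrite [(v (g j) + _)%R]addrC -mulr2n => /eqP.
  rewrite mulrn_eq0 /= addr_eq0 -eqr_oppLR eq_sym => /eqP ab.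
  move=> t tL; have [tj|tj] := ltnP t j.
    by rewrite (A1 t) ?subn0; [case: (odd t); rewrite ?oppr_eq0 | lia].
  by rewrite (A2 t) ?ab; [case: (odd _); rewrite ?oppr_eq0 | lia].
have A := @alternating (fun t => v (g t)) 0 L L0
   (fun i hi => W i hi (fun xi => nd (ex_intro _ i (conj hi (esym xi))))).
by move=> t tL; rewrite (A t) ?subn0; [case: (odd t); rewrite ?oppr_eq0 | lia].
Qed.

Lemma walk_at_double M N : sharp_condition e -> degA e M = degA e N -> ~ conn e [::] M N ->
  exists x g L, [/\ alt_walk e M N x g L \/ alt_walk e N M x g L,
  (forall i j, i < j < L -> x i = x j -> i = 0) &
  (forall j k, 0 < j < L -> 0 < k < L -> x 0 = x j -> x 0 = x k -> j = k /\ odd j)].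
Proof.
move=> sharp d nc; have pr := nconn_prim d nc; have [x [g [L w]]] := prim_walk pr.
have [[i [j [ij xij]]]|nd] := classic (exists i j, i < j < L /\ x i = x j); last first.
  exists x, g, L; split; first by left.
    by move=> i j ij xij; case: nd; exists i, j.
  by move=> j k j0 _ xj _; case: nd; exists 0, j.
exists (fun t => x (i + t)), (fun t => g (i + t)), L.
have w' := alt_walk_shift i w.
have pr' : prim e (if odd i then N else M) (if odd i then M else N).
  by case: (odd i) => //; exact: prim_sym.
have three a b : 0 < a < b -> b < L -> x (i + 0) = x (i + a) -> x (i + a) = x (i + b) -> False.
  by move=> ab bL; apply: (three_visits pr' w') => //.
split; first by move: w'; case: (odd i); [right|left].
  move=> a b ab xab; apply/eqP; apply: contraT; rewrite -lt0n => a0.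
  case: (@three a b); [lia|lia| |by []].
  rewrite addn0; apply: (double_vertex_unique noloop d nc sharp).
    exact: visits_deg d w ij xij.
  have [d' _ _] := pr'.
  have := visits_deg d' w' ab xab; rewrite /=.
  by case: (odd i) => //; rewrite d.
move=> a b a0 b0 xa xb; split; last exact: even_return pr' w' a0 xa.
have [h|h|//] := ltngtP a b.
  by case: (@three a b); [lia|lia|by []|rewrite -xa].
by case: (@three b a); [lia|lia|by []|rewrite -xb].
Qed.

(** A kernel vector supported properly inside [M - N] vanishes on some edge of the walk, hence on
    all of them. Coprimality holds because squarefreeness makes the nonzero coordinates units. *)
Lemma nconn_circuit M N : sharp_condition e -> degA e M = degA e N -> ~ conn e [::] M N ->
  is_circuit e M N.
Proof.
move=> sharp d nc; have pr := nconn_prim d nc; have [_ M0 _] := pr.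
have sqM i := nconn_squarefree noloop sharp i d nc.
have sqN i := nconn_squarefree noloop sharp i (esym d) (nconn_sym nc).
have dis i := @nconn_disjoint _ _ e M N i d nc.
have [i0 Mi0] := mnm_neq0P _ M0.
have Ni0 := dis _ Mi0.
split.
- move=> i; rewrite -leqn0 leqNgt; case: ltnP => //= Mi.
  by rewrite dis.
- by exists i0; rewrite Ni0; lia.
- move=> v; rewrite sumrB -!(big_morph Posz PoszD (erefl _)) -!degA_inc d subrr //.
- move=> v kv [i vi] /properP[sub [j ju jv]].
  have MN1 k : k \in supp (fun i => Posz (M i) - Posz (N i))%R -> M k + N k = 1.
    by rewrite inE; have := sqM k; have := sqN k; have := dis k; lia.
  have vs k : v k != 0%R -> M k + N k = 1.
    by move=> vk; apply/MN1/(subsetP sub); rewrite inE.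
  have vj : v j = 0%R by move: jv; rewrite inE negbK => /eqP.
  have [x [g [L [w inj dbl]]]] := walk_at_double sharp d nc.
  have img k : M k + N k = 1 -> exists2 t, t < L & g t = k.
    move=> h; case: w => w.
      have [] : 0 < M k \/ 0 < N k by lia.
        by rewrite (aw_M w) => /seg_gt0P[t [tL _ gt]]; exists t.
      by rewrite (aw_N w) => /seg_gt0P[t [tL _ gt]]; exists t.
    have [] : 0 < M k \/ 0 < N k by lia.
      by rewrite (aw_N w) => /seg_gt0P[t [tL _ gt]]; exists t.
    by rewrite (aw_M w) => /seg_gt0P[t [tL _ gt]]; exists t.
  have [t tL gt] := img _ (MN1 _ ju); have [t' tL' gt'] := img _ (vs _ vi).
  have c : forall t, t < L -> (v (g t) == 0%R) = (v (g 0) == 0%R).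
    case: w => w; first exact: ker_walk_const w kv vs inj dbl.
    by apply: ker_walk_const w kv _ inj dbl => k /vs; rewrite addnC.
  by move: vi; rewrite -gt' c // -(c t) // gt vj eqxx.
- apply/eqP; rewrite -dvdn1.
  apply: (@biggcdn_inf _ i0) => //.
  by rewrite Ni0; have := sqM i0; case: (M i0) Mi0 => [|[|]].
Qed.

Lemma walk_seq M N x g L : alt_walk e M N x g L ->
  [/\ even_closed_walk e (map g (iota 0 L)), Bw_plus (map g (iota 0 L)) = M &
      Bw_minus (map g (iota 0 L)) = N].
Proof.
move=> w.
have wexp par : walk_exp (map g (iota 0 L)) par = seg par g 0 L.
  apply/mnmP => i; rewrite mnmE size_map size_iota.
  have -> : zip (map g (iota 0 L)) (iota 0 L) = map (fun t => (g t, t)) (iota 0 L).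
    by elim: (iota 0 L) => //= t s ->.
  rewrite count_map -sum1_count mnm_sumE /index_iota subn0.
  rewrite big_mkcond [RHS]big_mkcond; apply: eq_bigr => t _ /=.
  by rewrite mnm1E; case: (_ == par) => //=; case: eqP.
rewrite /Bw_plus /Bw_minus !wexp -(aw_M w) -(aw_N w); split=> //.
split; first by rewrite size_map size_iota (aw_pos w).
split; first by rewrite size_map size_iota (aw_even w).
exists (x 0), (map x (iota 1 L)); split; first by rewrite !size_map !size_iota.
  clear wexp; case: L w => [/aw_pos //|L] w.
  have := iotaD 1 L 1; rewrite addn1 add1n => ->; rewrite map_cat last_cat /=.
  exact: aw_xL w.
have he := aw_edge w; elim: L {w wexp} 0 => //= L IH a; rewrite he /=.
exact: IH.
Qed.

End Circuits.

(** * Binomial generating systems *)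

Section Ideals.
Import GRing.Theory.
Local Open Scope ring_scope.
Variables (n m : nat) (e : 'I_m -> 'I_n * 'I_n) (K : fieldType).
Implicit Types (gs : seq {mpoly K[m]}) (f g : {mpoly K[m]}) (M N : 'X_{1..m}).
Implicit Types (S : seq ('X_{1..m} * 'X_{1..m})).

Lemma in_ideal0 gs : in_ideal gs 0.
Proof. by exists [::]; rewrite big1 // => i _; rewrite nth_nil mul0r. Qed.

Lemma in_idealD gs f g : in_ideal gs f -> in_ideal gs g -> in_ideal gs (f + g).
Proof.
move=> [cs ->] [ds ->]; exists (mkseq (fun i => cs`_i + ds`_i) (size gs)).
by rewrite -big_split; apply: eq_bigr => i _; rewrite nth_mkseq // mulrDl.
Qed.

Lemma in_idealM gs f g : in_ideal gs g -> in_ideal gs (f * g).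
Proof.
move=> [cs ->]; exists (mkseq (fun i => f * cs`_i) (size gs)).
by rewrite mulr_sumr; apply: eq_bigr => i _; rewrite nth_mkseq // mulrA.
Qed.

Lemma in_ideal_mem gs g : g \in gs -> in_ideal gs g.
Proof.
move=> gg; have ig : (index g gs < size gs)%N by rewrite index_mem.
exists (mkseq (fun i => (i == index g gs)%:R) (size gs)).
rewrite (bigD1 (Ordinal ig)) //= nth_mkseq // eqxx mul1r nth_index //.
rewrite big1 ?addr0 // => i; rewrite -val_eqE /= => /negPf ni.
by rewrite nth_mkseq // ni mul0r.
Qed.

Lemma toric_mapX M : toric_map e ('X_[M] : {mpoly K[m]}) = 'X_[degA e M].
Proof.
rewrite /toric_map comp_mpolyX /degA -mprodXE; apply: eq_bigr => i _.
by rewrite tnth_mktuple -mpolyXn mpolyXD.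
Qed.

Lemma mpolyX_inj : injective (fun d : 'X_{1..n} => 'X_[d] : {mpoly K[n]}).
Proof.
move=> d d' /(congr1 (mcoeff d)); rewrite !mcoeffX eqxx.
by case: eqP => // _ /eqP; rewrite oner_eq0.
Qed.

Lemma toric_binpoly M N : toric_ideal e (binpoly K (M, N)) <-> degA e M = degA e N.
Proof.
rewrite /toric_ideal /toric_map /binpoly comp_mpolyB /= -/(toric_map e _) -/(toric_map e _).
rewrite !toric_mapX subr_eq0; split=> [/eqP/mpolyX_inj //|->]; exact: eqxx.
Qed.

Lemma binpoly_trans gs M N P : in_ideal gs (binpoly K (M, N)) ->
  in_ideal gs (binpoly K (N, P)) -> in_ideal gs (binpoly K (M, P)).
Proof.
move=> h1 h2; rewrite (_ : binpoly K (M, P) = binpoly K (M, N) + binpoly K (N, P)).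
  exact: in_idealD.
by rewrite /binpoly /= addrA subrK.
Qed.

Lemma binpoly_sym gs M N : in_ideal gs (binpoly K (M, N)) -> in_ideal gs (binpoly K (N, M)).
Proof.
move=> h; rewrite (_ : binpoly K (N, M) = (-1) * binpoly K (M, N)); first exact: in_idealM.
by rewrite mulN1r /binpoly /= opprB.
Qed.

Definition homogeneous S := forall M N, (M, N) \in S -> degA e M = degA e N.

Lemma conn_deg S M N : homogeneous S -> conn e S M N -> degA e M = degA e N.
Proof.
move=> hS; elim=> // {}M {}N P st _ <-.
by case: st => [[]//|/orP[/hS|/hS]].
Qed.

(** A step that shares a variable is that variable times a binomial of smaller degree, so the proof
    is by induction on the degree. *)
Lemma conn_in_ideal S M N : homogeneous S ->
  (forall A B, degA e A = degA e B -> conn e S A B) -> degA e M = degA e N ->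
  in_ideal (map (binpoly K) S) (binpoly K (M, N)).
Proof.
move=> hS cS; move: {2}(mdeg M).+1 (ltnSn (mdeg M)) => s; elim: s M N => // s IH M N.
rewrite ltnS => Ms d; elim: (cS _ _ d) Ms => {M N d} [M|M N P st c IHc] Ms.
  by rewrite /binpoly subrr; exact: in_ideal0.
have dMN : degA e M = degA e N by case: st => [[]//|/orP[/hS|/hS]].
apply: binpoly_trans (IHc _); last by rewrite -(degA_mdeg dMN).
case: st => [[_ [i /andP[/mnm_split[M' eM] /mnm_split[N' eN]]]]|/orP[h|h]].
- rewrite (_ : binpoly K (M, N) = 'X_i * binpoly K (M', N')).
    apply/in_idealM/IH.
      by move: Ms; rewrite eM mdegD mdeg1 add1n.
    by apply: (@addmI _ (degA e U_(i))); rewrite -!degAD -eN -eM.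
  by rewrite /binpoly /= mulrBr -!mpolyXD -eM -eN.
- by apply: in_ideal_mem; apply: map_f.
- by apply: binpoly_sym; apply: in_ideal_mem; apply: map_f.
Qed.

(** Subtracting a multiple of a binomial removes a term of [f] without creating a new monomial. *)
Lemma toric_ideal_binomials gs : (forall M N, degA e M = degA e N -> in_ideal gs (binpoly K (M, N))) ->
  forall f, toric_ideal e f -> in_ideal gs f.
Proof.
move=> hb f; move: {2}(size (msupp f)).+1 (ltnSn (size (msupp f))) => s.
elim: s f => // s IH f hs tf.
case E : (msupp f) => [|M sf]; first by rewrite (msuppnil0 E); exact: in_ideal0.
have Mf : M \in msupp f by rewrite E mem_head.
(* Without a second term in the fiber of [M], the coefficient of [M] would survive in the image of
   [f]. *)
have [N [Nf NM dN]] : exists N, [/\ N \in msupp f, N != M & degA e M = degA e N].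
  apply: NNPP => nex; move: tf; rewrite /toric_ideal => /eqP /(congr1 (mcoeff (degA e M))).
  rewrite mcoeff0 {1}[f]mpolyE /toric_map (raddf_sum (comp_mpoly _)) raddf_sum /=.
  rewrite (bigD1_seq M) //= ?msupp_uniq // comp_mpolyZ -/(toric_map e _) toric_mapX.
  rewrite mcoeffZ mcoeffX eqxx mulr1 big_seq_cond big1 ?addr0.
    by move/eqP; rewrite mcoeff_eq0 Mf.
  move=> N /andP[Nf NM]; rewrite comp_mpolyZ -/(toric_map e _) toric_mapX.
  rewrite mcoeffZ mcoeffX; case: eqP => [h|_]; last by rewrite mulr0.
  by case: nex; exists N.
pose f' := f - f@_M *: binpoly K (M, N).
have -> : f = f' + (f@_M)%:MP * binpoly K (M, N) by rewrite mul_mpolyC subrK.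
apply: in_idealD; last by apply: in_idealM; exact: hb.
apply: IH.
  have sub : {subset msupp f' <= rem M (msupp f)}.
    move=> A; rewrite mem_rem_uniq ?msupp_uniq // inE !mcoeff_msupp /f'.
    rewrite mcoeffB mcoeffZ /binpoly /= mcoeffB !mcoeffX.
    have [<-|AM] := eqVneq M A; first by rewrite (negPf NM) subr0 mulr1 subrr eqxx.
    rewrite /=; have [<-|AN] := eqVneq N A; first by rewrite -mcoeff_msupp Nf.
    by rewrite subrr mulr0 subr0.
  have := uniq_leq_size (msupp_uniq f') sub; rewrite size_rem //.
  by move: hs; rewrite E /= ltnS => h1 h2; apply: leq_ltn_trans h2 _.
rewrite /toric_ideal /toric_map /f' comp_mpolyB comp_mpolyZ.
have /toric_binpoly := dN; rewrite /toric_ideal /toric_map => /eqP ->.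
by rewrite scaler0 subr0.
Qed.

(** The functional [l] sums the coefficients over the component of [M]. It kills every multiple of a
    generator, but equals 1 on the binomial of [M] and [N] if [N] lies in another component. *)
Lemma in_ideal_conn S M N : homogeneous S ->
  in_ideal (map (binpoly K) S) (binpoly K (M, N)) -> degA e M = degA e N -> conn e S M N.
Proof.
(* Truncation below degree [k] makes the sum finite and keeps [M] and [N]; by homogeneity both terms
   of a monomial multiple of a generator are kept or both are dropped. *)
move=> hS [cs Ecs] d; pose k := (mdeg M).+1.
have dec (A : 'X_{1..m < k}) : exists b : bool, b <-> conn e S M A.
  by have [c|nc] := classic (conn e S M A); [exists true | exists false].
have [P PP] := fin_all_exists dec.
pose l f := \sum_(A : 'X_{1..m < k}) f@_A *+ P A.
have lX (A : 'X_{1..m}) : (mdeg A < k)%N -> forall B : 'X_{1..m < k}, bmnm B = A -> l 'X_[A] = (P B)%:R.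
  move=> Ak B BA; rewrite /l (bigD1 B) //= mcoeffX -BA eqxx big1 ?addr0 // => C CB.
  by rewrite mcoeffX [_ == _]eq_sym -bmeqP (negPf CB) mul0rn.
have lXk (A : 'X_{1..m}) : (k <= mdeg A)%N -> l 'X_[A] = 0.
  move=> kA; rewrite /l big1 // => C _; rewrite mcoeffX; case: eqP => [AC|_]; last by rewrite mul0rn.
  by have := bmdeg C; rewrite -AC ltnNge kA.
have lB f g : l (f - g) = l f - l g.
  by rewrite /l -sumrB; apply: eq_bigr => A _; rewrite mcoeffB mulrnBl.
have lZ c f : l (c *: f) = c * l f.
  by rewrite /l mulr_sumr; apply: eq_bigr => A _; rewrite mcoeffZ mulrnAr.
have lsum I r (F : I -> {mpoly K[m]}) : l (\sum_(i <- r) F i) = \sum_(i <- r) l (F i).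
  rewrite /l exchange_big /=; apply: eq_bigr => A _.
  by rewrite raddf_sum sumrMnl.
have lgen c b : b \in S -> l (c * binpoly K b) = 0.
  case: b => a b ab; rewrite [c]mpolyE mulr_suml lsum big1 // => u _.
  rewrite -scalerAl lZ /binpoly /= mulrBr -!mpolyXD lB.
  have dab := hS _ _ ab; have mab : mdeg (u + a)%MM = mdeg (u + b)%MM.
    by rewrite !mdegD (degA_mdeg dab).
  have [uk|ku] := ltnP (mdeg (u + a)%MM) k; last by rewrite !lXk -?mab // subr0 mulr0.
  have ubk : (mdeg (u + b)%MM < k)%N by rewrite -mab.
  rewrite (lX _ uk (BMultinom uk)) // (lX _ ubk (BMultinom ubk)) //.
  suff -> : P (BMultinom uk) = P (BMultinom ubk) by rewrite subrr mulr0.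
  have cab : conn e S (u + a)%MM (u + b)%MM.
    have [->|/mnm_neq0P[i ui]] := eqVneq u 0%MM; first by rewrite !add0m; exact: conn_mem.
    apply: (@conn_share _ _ _ _ _ _ i); rewrite ?mnmDE ?addn_gt0 ?ui //.
    by rewrite !degAD dab.
  apply/idP/idP => /PP c0; apply/PP; first exact: conn_trans c0 cab.
  exact: conn_trans c0 (conn_sym cab).
have Nk : (mdeg N < k)%N by rewrite /k (degA_mdeg d).
have Mk : (mdeg M < k)%N by [].
have : l (binpoly K (M, N)) = 0.
  rewrite Ecs lsum big1 // => i _; have iS : (i < size S)%N by rewrite -(size_map (binpoly K)).
  by rewrite (nth_map (M, N)) // lgen // mem_nth.
rewrite /binpoly /= lB (lX _ Mk (BMultinom Mk)) // (lX _ Nk (BMultinom Nk)) //.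
have -> : P (BMultinom Mk) by apply/PP; exact: conn_refl.
case: (boolP (P (BMultinom Nk))) => [/PP //|_] /eqP.
by rewrite subr0 oner_eq0.
Qed.

Lemma gen_systemP S : binomial_gen_system e K S <->
  homogeneous S /\ (forall M N, degA e M = degA e N -> conn e S M N).
Proof.
split=> [[h1 h2]|[hS cS]].
  have hS : homogeneous S by move=> M N /h1 /toric_binpoly.
  split=> // M N d; apply: in_ideal_conn => //.
  by apply: h2; apply/toric_binpoly.
split=> [[M N] /hS d|]; first exact/toric_binpoly.
by apply: toric_ideal_binomials => M N; exact: conn_in_ideal.
Qed.

Lemma gen_system_rad S : binomial_gen_system e K S -> binomial_rad_gen e K S.
Proof. by case=> h1 h2; split=> // f tf; exists 1%N; rewrite expr1; exact: h2. Qed.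

End Ideals.

(** * Minimal systems and generation up to radical *)

Section Systems.
Variables (n m : nat) (e : 'I_m -> 'I_n * 'I_n) (K : fieldType).
Hypothesis noloop : forall i, (e i).1 != (e i).2.
Hypothesis simple : forall i j, edge_is e j (e i).1 (e i).2 -> i = j.
Hypothesis sharp : sharp_condition e.
Implicit Types (M N A B : 'X_{1..m}) (S : seq ('X_{1..m} * 'X_{1..m})).

Lemma least_nat (P : nat -> Prop) : (exists k, P k) ->
  exists k, P k /\ forall k', P k' -> k <= k'.
Proof.
case=> k; move: {2}k.+1 (ltnSn k) => s; elim: s k => // s IH k ks Pk.
have [[k' [k'k Pk']]|nex] := classic (exists k', k' < k /\ P k').
  by apply: (IH k') => //; exact: leq_trans k'k _.
exists k; split=> // k' Pk'; rewrite leqNgt; apply/negP => k'k.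
by case: nex; exists k'.
Qed.

(** Disconnected monomials are squarefree, hence of degree at most [m], so the finitely many
    binomials in this range suffice. *)
Lemma gen_system_exists : exists S, binomial_gen_system e K S.
Proof.
pose T : finType := ('X_{1..m < m.+1} * 'X_{1..m < m.+1})%type.
exists [seq (bmnm p.1, bmnm p.2) | p : T <- enum T & degA e p.1 == degA e p.2].
apply/gen_systemP; split=> [M N /mapP[p]|M N d].
  by rewrite mem_filter => /andP[/eqP h _] [-> ->].
have [c|nc] := classic (conn e [::] M N); first exact: conn0_sub.
have bd A : (forall i, A i <= 1) -> mdeg A < m.+1.
  move=> sq; rewrite mdegE ltnS -[X in _ <= X]card_ord -sum1_card.
  by apply: leq_sum => i _; exact: sq.
have Mb := bd M (fun i => nconn_squarefree noloop sharp i d nc).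
have Nb := bd N (fun i => nconn_squarefree noloop sharp i (esym d) (nconn_sym nc)).
apply/conn_mem/mapP; exists (BMultinom Mb, BMultinom Nb) => //.
by rewrite mem_filter /= d eqxx mem_enum.
Qed.

(* Replacing M, in any generating system, by a neighbour in its component gives a
   generating system that avoids M. *)
Lemma indispensable_indisp M N : indispensable_monomial e K M -> N <> M ->
  degA e N = degA e M -> indisp e M.
Proof.
move=> ind NM dN; split; first by exists N.
move=> M' Y eM Y0 N' dN'; apply: NNPP => N'M'.
pose M2 := (N' + Y)%MM; pose r A := if A == M then M2 else A.
have M2M : M2 != M by apply/eqP; rewrite eM => /addIm.
have cM : conn e [::] M M2.
  have /mnm_neq0P[i Yi] := Y0; apply: (@conn_share _ _ _ _ _ _ i).
  - by rewrite eM !degAD dN'.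
  - by rewrite eM mnmDE; lia.
  - by rewrite mnmDE; lia.
have cr S A : conn e S A (r A).
  by rewrite /r; case: eqP => [->|_]; [exact: conn0_sub | exact: conn_refl].
have [S gS] := gen_system_exists; have [hS cS] := (gen_systemP e K S).1 gS.
have hr : homogeneous e (map (fun b => (r b.1, r b.2)) S).
  move=> A B /mapP[[a b] /hS d [-> ->]] /=.
  have dr c : degA e (r c) = degA e c.
    by rewrite (conn_deg _ (cr [::] c)).
  by rewrite !dr.
have [|b /mapP[b0 _ ->] /=] := ind (map (fun b => (r b.1, r b.2)) S).
  apply/gen_systemP; split=> // A B /cS; elim=> {A B} [A|A B C st _ IH].
    exact: conn_refl.
  apply: conn_trans IH; case: st => [h|h].
    by apply: conn_step (conn_refl _ _ _); left.
  apply: conn_trans (cr _ A) _; apply: conn_trans (conn_sym (cr _ B)).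
  by case/orP: h => h; [|apply: conn_sym]; apply: conn_mem; apply/mapP; [exists (A, B)|exists (B, A)].
have rM c : r c != M by rewrite /r; case: (eqVneq c M).
by rewrite !(negPf (rM _)) andbF.
Qed.

Lemma conn_cons S b M N : conn e (b :: S) M N ->
  [\/ conn e S M N, conn e S M b.1 /\ conn e S b.2 N | conn e S M b.2 /\ conn e S b.1 N].
Proof.
elim=> {M N} [M|M N P st _ IH]; first by apply: Or31; exact: conn_refl.
have [cMN|bMN] : conn e S M N \/ (b = (M, N) \/ b = (N, M)).
  case: st => [h|].
    by left; apply: conn_step (conn_refl _ _ _); left.
  rewrite !inE => /orP[/orP[/eqP <-|h]|/orP[/eqP <-|h]].
  - by right; left.
  - by left; exact: conn_mem.
  - by right; right.
  - by left; apply/conn_sym/conn_mem.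
- case: IH => [c|[c1 c2]|[c1 c2]]; [apply: Or31|apply: Or32|apply: Or33]; rewrite ?c2;
    try split=> //; exact: conn_trans cMN _.
- case: bMN => ->  /= in IH *; case: IH => [c|[c1 c2]|[c1 c2]].
  + by apply: Or32; split=> //; exact: conn_refl.
  + by apply: Or32; split=> //; exact: conn_refl.
  + by apply: Or31.
  + by apply: Or33; split=> //; exact: conn_refl.
  + by apply: Or31.
  + by apply: Or33; split=> //; exact: conn_refl.
Qed.

(** [b :: suf] is the shortest suffix of [S] that connects [M] to [N]; a chain in it needs [b] only
    once. *)
Lemma conn_exchange S M N : ~ conn e [::] M N -> conn e S M N ->
  exists pre b suf, S = pre ++ b :: suf /\
    (conn e suf M b.1 /\ conn e suf b.2 N \/ conn e suf M b.2 /\ conn e suf b.1 N).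
Proof.
move=> nc; elim: S => [//|b S IH] /conn_cons c.
have [cS|ncS] := classic (conn e S M N).
  have [pre [b' [suf [-> h]]]] := IH cS.
  by exists (b :: pre), b', suf.
by exists [::], b, S; split=> //; case: c => // h; [left | right].
Qed.

(** In a generating system of least size, a link [b] between the components of [M] and [N] is
    exchanged for [(M, N)]. The size is unchanged, so the new system is minimal. *)
Lemma nconn_minimal_binomial M N : degA e M = degA e N -> ~ conn e [::] M N ->
  minimal_binomial e (binpoly K (M, N)).
Proof.
move=> d nc.
have [|k [[S [gS Sk]] kmin]] :=
    @least_nat (fun k => exists S, binomial_gen_system e K S /\ size S = k).
  by have [S gS] := gen_system_exists; exists (size S), S.
have [hS cS] := (gen_systemP e K S).1 gS.
have [pre [b [suf [eS link]]]] := conn_exchange nc (cS _ _ d).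
pose S' := (M, N) :: pre ++ suf.
have sS' : size S' = k by rewrite -Sk eS /= !size_cat addnS.
have sub_suf : {subset suf <= S'} by move=> a h; rewrite inE mem_cat h !orbT.
have gS' : binomial_gen_system e K S'.
  apply/gen_systemP; split=> [A B|A B].
    rewrite inE => /orP[/eqP[-> ->] //|h]; apply: hS.
    by move: h; rewrite eS !mem_cat inE => /orP[->|->] //; rewrite !orbT.
  move=> /cS; elim=> {A B} [A|A B C st _ IH]; first exact: conn_refl.
  apply: conn_trans IH.
  have cMN : conn e S' M N by apply: conn_mem; rewrite mem_head.
  have cb : conn e S' b.1 b.2.
    case: link => -[/(conn_sub sub_suf) c1 /(conn_sub sub_suf) c2].
      exact: conn_trans (conn_sym c1) (conn_trans cMN (conn_sym c2)).
    exact: conn_trans c2 (conn_trans (conn_sym cMN) c1).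
  have inS A' B' : (A', B') \in S -> conn e S' A' B'.
    rewrite eS mem_cat inE => /or3P[h|/eqP h|h]; last exact: conn_mem (sub_suf _ h).
      by apply: conn_mem; rewrite inE mem_cat h orbT.
    by move: cb; rewrite -h.
  case: st => [h|/orP[/inS //|/inS]]; last exact: conn_sym.
  by apply: conn_step (conn_refl _ _ _); left.
exists S'; split; last by apply: map_f; rewrite mem_head.
split=> //; split.
  apply: contraT => nu; have := kmin (size (undup S')).
  rewrite leqNgt -sS' ltn_size_undup nu; apply.
  exists (undup S'); split=> //; have [hS' cS'] := (gen_systemP e K S').1 gS'.
  apply/gen_systemP; split=> [A B|A B /cS']; first by rewrite mem_undup; exact: hS'.
  by apply: conn_sub => a; rewrite mem_undup.
move=> b' b'S gr; have := kmin (size (rem b' S')).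
rewrite size_rem // sS' => /(_ (ex_intro _ _ (conj gr _))).
by rewrite size_rem // sS' => /(_ erefl); move: sS'; rewrite /=; lia.
Qed.

Hypothesis no_bad_circuit : ~ exists w : seq 'I_m,
      [/\ even_closed_walk e w,
          minimal_binomial e (Bw K w),
          is_circuit e (Bw_plus w) (Bw_minus w),
          squarefree (Bw_plus w) /\ squarefree (Bw_minus w)
        & ~ indispensable_monomial e K (Bw_plus w) /\
          ~ indispensable_monomial e K (Bw_minus w)].

(** Otherwise [M - N], written as [B_w], would be a minimal binomial of the kind excluded by
    [no_bad_circuit]. *)
Lemma nconn_dichotomy M N : degA e M = degA e N -> ~ conn e [::] M N ->
  indisp e M \/ indisp e N.
Proof.
move=> d nc; have pr := nconn_prim d nc; have [x [g [L w]]] := prim_walk pr.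
have MN : M <> N by move=> h; apply: nc; rewrite h; exact: conn_refl.
apply: NNPP => nind; apply: no_bad_circuit.
have [ew eM eN] := walk_seq w; exists (map g (iota 0 L)).
rewrite /Bw eM eN; split=> //.
- exact: nconn_minimal_binomial.
- exact: nconn_circuit.
- split; apply/forallP => i.
    exact: (nconn_squarefree noloop sharp i d nc).
  exact: (nconn_squarefree noloop sharp i (esym d) (nconn_sym nc)).
- split=> h; apply: nind; [left | right].
    by apply: (indispensable_indisp h (N := N)) => // /esym.
  by apply: (indispensable_indisp h (N := M)).
Qed.

Definition same_supp M N := forall i, (0 < M i) = (0 < N i).

Import GRing.Theory.

(* Evaluate at the indicator function of the support of M. *)
Lemma rad_gen_support S M : binomial_rad_gen e K S -> indisp e M ->
  exists2 b, b \in S & b.1 <> b.2 /\ (same_supp b.1 M \/ same_supp b.2 M).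
Proof.
move=> [hS rS] iM; have [[N NM dN] _] := iM.
have nc := indisp_nconn iM NM.
pose p i : K := ((0 < M i)%N%:R)%R.
pose inM A := [forall i, (0 < A i) ==> (0 < M i)].
have pX A : (('X_[A] : {mpoly K[m]}).@[p] = (inM A)%:R)%R.
  rewrite mevalX; case: (boolP (inM A)) => [/forallP h|/forallPn[i]].
    rewrite big1 // => i _; have := h i; rewrite /p lt0n; case: eqP => [->|_] /=.
      by rewrite expr0.
    by move=> ->; rewrite expr1n.
  rewrite negb_imply => /andP[Ai Mi]; rewrite (bigD1 i) //= /p (negPf Mi).
  by rewrite expr0n -[A i == 0]negbK -lt0n Ai mul0r.
apply: NNPP => nex.
have homS b : b \in S -> degA e b.1 = degA e b.2.
  by case: b => a b /hS /toric_binpoly.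
have zero b : b \in S -> ((binpoly K b).@[p] = 0)%R.
  move=> bS; rewrite /binpoly mevalB !pX.
  have [->|/eqP b12] := eqVneq b.1 b.2; first by rewrite subrr.
  (* A monomial supported in [M] and having a partner is a multiple of [M], so it has the support of
     [M]. Under [nex], both monomials of a nontrivial binomial of [S] therefore vanish at [p]. *)
  have nsub A B : degA e A = degA e B -> A <> B -> ~ same_supp A M -> inM A = false.
    move=> dAB AB ns; apply/negP => /forallP h.
    have sub i : 0 < A i -> 0 < M i by move=> Ai; have := h i; rewrite Ai.
    have [Z eA] := indisp_min noloop sharp iM dAB AB sub.
    by apply: ns => i; apply/idP/idP => [/sub //|]; rewrite eA mnmDE; lia.
  rewrite (@nsub b.1 b.2) ?(@nsub b.2 b.1) ?subrr //.
  - exact/esym/homS.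
  - by move=> /esym.
  - by move=> h; apply: nex; exists b => //; split=> //; right.
  - exact: homS.
  - by move=> h; apply: nex; exists b => //; split=> //; left.
have tMN : toric_ideal e (binpoly K (M, N)) by apply/toric_binpoly.
have [k [cs Ecs]] := rS _ tMN.
have := congr1 (meval p) Ecs; rewrite rmorphXn /= /binpoly mevalB !pX /=.
have -> : inM M by apply/forallP => i; exact: implybb.
have -> : inM N = false.
  have [_ Mn0 _] := nconn_prim (esym dN) nc.
  have /mnm_neq0P[i Ni] := degA_neq0 (esym dN) Mn0.
  apply/negP => /forallP /(_ i); rewrite Ni /= => Mi.
  by have := nconn_disjoint (esym dN) nc Mi; lia.
rewrite subr0 expr1n raddf_sum /= big1 => [/eqP|i _]; first by rewrite oner_eq0.
rewrite mevalM (nth_map (M, N)) ?zero ?mulr0 //; last first.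
  by rewrite -(size_map (binpoly K)).
by apply: mem_nth; rewrite -(size_map (binpoly K)).
Qed.

Lemma same_supp_inj M N : indisp e M -> indisp e N -> same_supp M N -> M = N.
Proof.
move=> iM iN h; apply/mnmP => i; have := h i.
have := indisp_squarefree noloop sharp i iM; have := indisp_squarefree noloop sharp i iN.
lia.
Qed.

Lemma seq_choice (T U : eqType) (R : T -> U -> Prop) (s : seq T) :
  (forall b, b \in s -> exists c, R b c) ->
  exists t : seq U, [/\ size t = size s, (forall b, b \in s -> exists2 c, c \in t & R b c) &
    (forall c, c \in t -> exists2 b, b \in s & R b c)].
Proof.
elim: s => [|b s IH] h; first by exists [::].
have [c Rbc] := h b (mem_head _ _).
have [|t [st h1 h2]] := IH; first by move=> a as_; apply: h; rewrite inE as_ orbT.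
exists (c :: t); split=> /=; first by rewrite st.
- move=> a; rewrite inE => /orP[/eqP ->|/h1[d dt Rd]]; first by exists c; rewrite ?mem_head.
  by exists d; rewrite // inE dt orbT.
- move=> d; rewrite inE => /orP[/eqP ->|/h2[a as_ Rd]]; first by exists b; rewrite ?mem_head.
  by exists a; rewrite // inE as_ orbT.
Qed.

(* Each binomial of S whose supports are those of one or two indispensable
   monomials is replaced by a binomial involving these monomials. *)
Lemma gen_of_rad_gen S : binomial_rad_gen e K S ->
  exists S0, binomial_gen_system e K S0 /\ size S0 = size S.
Proof.
move=> rS; have [hS _] := rS.
pose R (b c : 'X_{1..m} * 'X_{1..m}) := degA e c.1 = degA e c.2 /\
  forall M, indisp e M -> b.1 <> b.2 -> same_supp b.1 M \/ same_supp b.2 M ->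
    exists2 N, N <> M & c = (M, N) \/ c = (N, M).
have [|S0 [sS0 h1 h2]] := @seq_choice _ _ R S.
  move=> b bS.
  have db : degA e b.1 = degA e b.2 by case: b bS => a b /hS /toric_binpoly.
  (* The trivial binomial [(0, 0)] serves as a placeholder that keeps the number of elements. *)
  have [b12|b12] := classic (b.1 = b.2); first by exists (0%MM, 0%MM); split.
  have [[M1 [iM1 s1]]|n1] := classic (exists M, indisp e M /\ same_supp b.1 M).
    have [[M2 [iM2 s2 M12]]|n2] := classic (exists M, [/\ indisp e M, same_supp b.2 M & M1 <> M]).
      exists (M1, M2); split; first by exact: (indisp_same_deg noloop sharp iM1 iM2 db b12 s1 s2).
      move=> M iM _ [s|s].
        have -> : M = M1 by apply: same_supp_inj => // i; rewrite -s s1.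
        by exists M2; [move=> /esym|left].
      have -> : M = M2 by apply: same_supp_inj => // i; rewrite -s s2.
      by exists M1; [|right].
    have [[N NM dN] _] := iM1; exists (M1, N); split; first exact: esym.
    move=> M iM _ sM; suff -> : M = M1 by exists N; [|left].
    case: sM => s; first by apply: same_supp_inj => // i; rewrite -s s1.
    by apply: NNPP => h; apply: n2; exists M; split=> // /esym.
  have [[M2 [iM2 s2]]|n2] := classic (exists M, indisp e M /\ same_supp b.2 M).
    have [[N NM dN] _] := iM2; exists (M2, N); split; first exact: esym.
    move=> M iM _ [s|s]; first by case: n1; exists M.
    have -> : M = M2 by apply: same_supp_inj => // i; rewrite -s s2.
    by exists N; [|left].
  exists (0%MM, 0%MM); split=> // M iM _ [s|s]; first by case: n1; exists M.
  by case: n2; exists M.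
exists S0; split=> //.
have hS0 M N : (M, N) \in S0 -> degA e M = degA e N by move=> /h2[b _ []].
apply/gen_systemP; split; first exact: hS0.
move=> A B dAB.
apply: (indisp_links_conn noloop simple nconn_dichotomy hS0 _ dAB) => {A B dAB} M iM.
have [b bS [b12 sb]] := rad_gen_support rS iM.
have [c cS0 [_ Rc]] := h1 b bS.
by have [N NM [ec|ec]] := Rc M iM b12 sb; exists N; rewrite // -ec cS0 ?orbT.
Qed.

(** Generating systems also generate up to radical, and [gen_of_rad_gen] turns a smallest radical
    system into a generating system of the same size. *)
Lemma bar_eq_mu : exists k, is_bar e K k /\ is_mu e K k.
Proof.
have [|k [[S [rS Sk]] kmin]] :=
    @least_nat (fun k => exists S, binomial_rad_gen e K S /\ size S = k).
  by have [S /gen_system_rad gS] := gen_system_exists; exists (size S), S.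
have bar_le S' : binomial_rad_gen e K S' -> k <= size S' by move=> rS'; apply: kmin; exists S'.
exists k; split; first by split=> //; exists S.
have [S0 [gS0 sS0]] := gen_of_rad_gen rS.
split; first by exists S0; rewrite sS0.
by move=> S' /gen_system_rad; exact: bar_le.
Qed.

End Systems.

Theorem theorem3p14 (K : fieldType) (n m : nat) (e : 'I_m -> 'I_n * 'I_n) :
  simple_graph e ->
  connected_graph e ->
  sharp_condition e ->
  (~ exists w : seq 'I_m,
      [/\ even_closed_walk e w,
          minimal_binomial e (Bw K w),
          is_circuit e (Bw_plus w) (Bw_minus w),
          squarefree (Bw_plus w) /\ squarefree (Bw_minus w)
        & ~ indispensable_monomial e K (Bw_plus w) /\
          ~ indispensable_monomial e K (Bw_minus w)]) ->
  exists k : nat, is_bar e K k /\ is_mu e K k.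
Proof.
move=> [noloop simple] _ sharp no_bad; exact: bar_eq_mu.
Qed.
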